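(* Let $\Omega=(a,b)$ be a finite interval, $0<\alpha<1$ and $1\le p<\infty$, and fix a sign $\pm$. Then there exists a constant $C=C(\alpha,\Omega)>0$ such that $$\|u-c_{\pm}^{1-\alpha}\kappa_{\pm}^{\alpha}\|_{L^p(\Omega)}\le C\,\|{}^{\pm}\mathcal{D}^{\alpha}u\|_{L^p(\Omega)}\qquad\forall\,u\in{}^{\pm}W^{\alpha,p}(\Omega).$$
   Context: Fractional integrals on $(a,b)$, for $\sigma>0$: ${}^{-}I^{\sigma}f(x)=\frac{1}{\Gamma(\sigma)}\int_a^x\frac{f(y)}{(x-y)^{1-\sigma}}\,dy$ and ${}^{+}I^{\sigma}f(x)=\frac{1}{\Gamma(\sigma)}\int_x^b\frac{f(y)}{(y-x)^{1-\sigma}}\,dy$. For $0<\alpha<1$: ${}^{-}D^{\alpha}\varphi=\frac{d}{dx}\,{}^{-}I^{1-\alpha}\varphi$ and ${}^{+}D^{\alpha}\varphi=-\frac{d}{dx}\,{}^{+}I^{1-\alpha}\varphi$. Weak fractional derivatives ($0<\alpha<1$): for $u\in L^1(\Omega)$, $v\in L^1_{loc}(\Omega)$ is the left (resp. right) weak fractional derivative of $u$, written ${}^{-}\mathcal{D}^{\alpha}u=v$ (resp. ${}^{+}\mathcal{D}^{\alpha}u=v$), if $\int_\Omega v\varphi\,dx=\int_\Omega u\,{}^{+}D^{\alpha}\varphi\,dx$ (resp. with ${}^{-}D^{\alpha}\varphi$ on the right-hand side) for all $\varphi\in C_0^\infty(\Omega)$. ${}^{\pm}W^{\alpha,p}(\Omega)=\{u\in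 L^p(\Omega):{}^{\pm}\mathcal{D}^{\alpha}u\in L^p(\Omega)\}$. Kernel functions: $\kappa_-^{\alpha}(x)=(x-a)^{\alpha-1}$ and $\kappa_+^{\alpha}(x)=(b-x)^{\alpha-1}$. Constants (depending on $u$): $c_-^{1-\alpha}=\frac{({}^{-}I^{1-\alpha}u)(a)}{\Gamma(\alpha)}$ and $c_+^{1-\alpha}=\frac{({}^{+}I^{1-\alpha}u)(b)}{\Gamma(\alpha)}$, where ${}^{\pm}I^{1-\alpha}u$ is identified with its absolutely continuous representative on $[a,b]$ in order to take the endpoint value. *)

(* Defs.v *)
From HB Require Import structures.
From mathcomp Require Import all_boot all_order all_algebra.
From mathcomp Require Import all_classical all_reals all_analysis.

Set Implicit Arguments.
Unset Strict Implicit.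
Unset Printing Implicit Defensive.
Import Order.TTheory GRing.Theory Num.Theory.
Import numFieldNormedType.Exports.

Local Open Scope classical_set_scope.
Local Open Scope ring_scope.

Definition Gamma {R : realType} (s : R) : R :=
  \int[lebesgue_measure]_(t in `]0, +oo[) (t `^ (s - 1) * expR (- t)).

(* Functions are only ever considered on D: the values outside D are replaced
   by 0, so that the norm of the library, which integrates over the whole line,
   is the norm of L^p(D). *)
Definition inLp {R : realType} (p : R) (D : set R) (f : R -> R) : Prop :=
  f \_ D \in Lfun (@lebesgue_measure R) p%:E.

Definition normLp {R : realType} (p : R) (D : set R) (f : R -> R) : \bar R :=
  ('N[@lebesgue_measure R]_p%:E[EFin \o (f \_ D)])%E.

Variant side := Left | Right.

Definition opp_side (s : side) : side :=
  match s with Left => Right | Right => Left end.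

Definition fracI {R : realType} (s : side) (a b sigma : R) (f : R -> R)
    (x : R) : R :=
  (Gamma sigma)^-1 *
  match s with
  | Left => \int[lebesgue_measure]_(y in `]a, x[)
              (f y / (x - y) `^ (1 - sigma))
  | Right => \int[lebesgue_measure]_(y in `]x, b[)
              (f y / (y - x) `^ (1 - sigma))
  end.

Definition fracD {R : realType} (s : side) (a b alpha : R) (phi : R -> R)
    (x : R) : R :=
  match s with
  | Left => (fracI Left a b (1 - alpha) phi)^`()%classic x
  | Right => - (fracI Right a b (1 - alpha) phi)^`()%classic x
  end.

Definition test_function {R : realType} (D : set R) (phi : R -> R) : Prop :=
  [/\ forall (n : nat) (x : R), derivable (phi^`(n))%classic x 1,
      compact (closure [set x | phi x != 0]) &
      closure [set x | phi x != 0] `<=` D].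

(* A relation, since v is determined by u only almost everywhere. *)
Definition is_weak_fracD {R : realType} (s : side) (a b alpha : R)
    (u v : R -> R) : Prop :=
  [/\ inLp 1 `]a, b[ u, locally_integrable `]a, b[ v &
      forall phi : R -> R, test_function `]a, b[ phi ->
        \int[lebesgue_measure]_(x in `]a, b[) (v x * phi x) =
        \int[lebesgue_measure]_(x in `]a, b[)
          (u x * fracD (opp_side s) a b alpha phi x)].

Definition fracW {R : realType} (s : side) (a b alpha p : R) : set (R -> R) :=
  [set u | inLp p `]a, b[ u /\
     exists2 v, is_weak_fracD s a b alpha u v & inLp p `]a, b[ v].

Definition kappa {R : realType} (s : side) (a b alpha x : R) : R :=
  match s with
  | Left => (x - a) `^ (alpha - 1)
  | Right => (b - x) `^ (alpha - 1)
  end.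

Definition abs_continuous {R : realType} (a b : R) (g : R -> R) : Prop :=
  forall e : R, 0 < e -> exists2 d : R, 0 < d &
    forall (n : nat) (x y : 'I_n -> R),
      (forall i, a <= x i /\ x i <= y i /\ y i <= b) ->
      trivIset setT (fun i => [set` `]x i, y i[]) ->
      \sum_(i < n) (y i - x i) < d ->
      \sum_(i < n) `|g (y i) - g (x i)| < e.

(* The value at x0, a point of [a, b], of the absolutely continuous
   representative of f, the same for all such representatives; the default 0
   when f has none. *)
Definition ac_value {R : realType} (a b : R) (f : R -> R) (x0 : R) : R :=
  xget 0 [set c | exists g : R -> R,
    [/\ abs_continuous a b g,
        {ae @lebesgue_measure R, forall x, `]a, b[%classic x -> g x = f x} &
        c = g x0]].

Definition cst_c {R : realType} (s : side) (a b alpha : R) (u : R -> R) : R :=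
  ac_value a b (fracI s a b (1 - alpha) u)
    (match s with Left => a | Right => b end) / Gamma alpha.

(* Main.v *)
Require Import Defs.
From mathcomp Require Import all_boot all_order all_algebra.
From mathcomp Require Import ring lra.
From mathcomp Require Import all_classical all_reals all_analysis.
From mathcomp Require Import measurable_realfun.

Set Implicit Arguments.
Unset Strict Implicit.
Unset Printing Implicit Defensive.
Import Order.TTheory GRing.Theory Num.Theory.
Import numFieldNormedType.Exports.

Local Open Scope classical_set_scope.
Local Open Scope ring_scope.

(* The operator u |-> I^(1-al) u is a convolution with a power kernel, and moving
   it onto the test function by Fubini turns the weak equation D^al u = v into
   the statement that I^(1-al) u - I^1 v has zero weak derivative.  By
   du Bois-Reymond it is a.e. a constant c0, and since I^1 v is absolutely
   continuous and vanishes at the endpoint, c0 is the endpoint value of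
   I^(1-al) u.  Applying I^al and using the semigroup law (i.e. the Beta integral
   B(al, 1-al) = Gamma(al) Gamma(1-al)) gives
     I^1 u = I^1 (c0 / Gamma(al) * kappa + I^al v),
   hence u - c kappa = I^al v a.e., and Young's inequality bounds the L^p norm of
   I^al v by the L^1 norm of the kernel on ]0, b - a[ times that of v. *)

(** A real-valued integral takes the default value 0 when it diverges, and the convolution of an L^1
    function with t^(sigma-1) converges only almost everywhere. Every exchange of integrals
    therefore goes through one Fubini statement for kernels, whose two sides are compared with the
    true iterated integrals almost everywhere. The reason for applying I^al is the following: the
    equation for I^(1-al) u holds only a.e., but integrating it against the kernel of order al gives
    an identity between order-one integrals at every point z, and Lebesgue differentiation turns
    that into an a.e. identity for u itself. Two singular factors meet in this exchange; the Beta
    integral, besides giving the value, is the bound uniform in y that makes it legitimate. Left and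
    right are handled together through a sign e = 1 or -1, which is why substitutions of slope 1 and
    -1 are all that the convolutions require. The kernel does not change with p, so the constant
    from Young's inequality is the same for all p. *)

(** * Affine change of variables for Lebesgue measure *)

Section affine_substitution.
Context {R : realType}.
Local Notation mu := (@lebesgue_measure R).
Local Open Scope ereal_scope.

Lemma measurable_affine (c d : R) :
  measurable_fun [set: R] (fun t : R => c * t + d : measurableTypeR R)%R.
Proof.
apply: measurable_funD => //; apply: measurable_funM => //.
Qed.

(** By uniqueness of Lebesgue measure it suffices that the pushforward scaled by |c| gives each
    interval ]x, y] its length. For c < 0 the preimage has its ends exchanged and is closed on the
    left, with the same length. *)
Lemma lebesgue_measure_affine (c d : R) (A : set R) : c != 0%R ->
  measurable A -> mu A = `|c|%:E * mu ((fun t => c * t + d)%R @^-1` A).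
Proof.
move=> c0 mA.
pose phi := (fun t : R => c * t + d : measurableTypeR R)%R.
have mphi : measurable_fun [set: measurableTypeR R] phi by exact: measurable_affine.
have cn0 : (0 <= `|c|)%R by [].
pose m := mscale (NngNum cn0) (pushforward mu phi).
have -> : `|c|%:E * mu ((fun t => c * t + d)%R @^-1` A) = m mphi A by [].
apply: lebesgue_measure_unique mA => _ [[x y]] _ <-.
rewrite lebesgue_measure_itv/= lte_fin.
transitivity (`|c|%:E * mu (phi @^-1` `]x, y])); last by [].
have [c_gt0|c_lt0|/esym/eqP] := ltgtP 0%R c; last by rewrite (negbTE c0).
- rewrite (_ : _ @^-1` _ = `]((x - d) / c)%R, ((y - d) / c)%R]%classic); last first.
    apply/seteqP; split=> t /=; rewrite !in_itv/=
      ltr_pdivrMr// ler_pdivlMr// ltrBlDr lerBrDr mulrC //.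
  rewrite lebesgue_measure_itv/= lte_fin ltr_pM2r ?invr_gt0// ltrD2r.
  case: ifPn => xy; last by rewrite mule0.
  by rewrite -EFinB -EFinM gtr0_norm// -mulrBl mulrC divfK//; congr (_%:E); ring.
- rewrite (_ : _ @^-1` _ = `[((y - d) / c)%R, ((x - d) / c)%R[%classic); last first.
    apply/seteqP; split=> t /=; rewrite !in_itv/=
      ltr_ndivlMr// ler_ndivrMr// ltrBlDr lerBrDr mulrC andbC //.
  rewrite lebesgue_measure_itv/= lte_fin ltr_nM2r ?invr_lt0// ltrD2r.
  case: ifPn => xy; last by rewrite mule0.
  rewrite -EFinB -EFinM ltr0_norm// -mulrBl mulrC mulrN divfK//.
  by congr (_%:E); ring.
Qed.

Lemma ge0_integral_affine (c d : R) (f : R -> \bar R) : c != 0%R ->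
  measurable_fun setT f -> (forall x, 0 <= f x) ->
  \int[mu]_x f x = `|c|%:E * \int[mu]_t f (c * t + d)%R.
Proof.
move=> c0 mf f0; have cn0 : (0 <= `|c|)%R by [].
pose phi := (fun t : R => c * t + d : measurableTypeR R)%R.
have mphi : measurable_fun [set: measurableTypeR R] phi by exact: measurable_affine.
rewrite (eq_measure_integral (mscale (NngNum cn0) (pushforward mu phi))); last first.
  by move=> A mA _; exact: lebesgue_measure_affine.
rewrite ge0_integral_mscale//= ge0_integral_pushforward//.
Qed.

(** With |c| = 1 the positive and negative parts keep their integrals separately, so the difference
    is preserved even when it is infinite. *)
Lemma integral_affine1 (c d : R) (f : R -> \bar R) : `|c|%R = 1%R ->
  measurable_fun setT f -> \int[mu]_x f x = \int[mu]_t f (c * t + d)%R.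
Proof.
move=> c1 mf; have c0 : c != 0%R by rewrite -normr_eq0 c1 oner_eq0.
rewrite integralE [RHS]integralE; congr (_ - _).
  rewrite (ge0_integral_affine d c0) ?c1 ?mul1e; last 2 first.
  - exact: measurable_funepos.
  - exact: funepos_ge0.
  by congr integral; apply/funext => t; rewrite !funeposE.
rewrite (ge0_integral_affine d c0) ?c1 ?mul1e; last 2 first.
- exact: measurable_funeneg.
- exact: funeneg_ge0.
by congr integral; apply/funext => t; rewrite !funenegE.
Qed.

End affine_substitution.

(** * Fubini's theorem for a kernel between two functions of one variable *)

Section kernel_fubini.
Context {R : realType}.
Local Notation mu := (@lebesgue_measure R).

Lemma measurable_Rintegral_section (H : R * R -> R) :
  measurable_fun setT H -> measurable_fun setT (fun x => \int[mu]_y H (x, y)).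
Proof.
move=> mH; apply: measurableT_comp => //=.
have mEH : measurable_fun setT (EFin \o H) by exact/measurable_EFinP.
rewrite (_ : (fun x => _) = fun x =>
  ((\int[mu]_y (EFin \o H)^\+ (x, y)) - (\int[mu]_y (EFin \o H)^\- (x, y)))%E).
  apply: emeasurable_funB.
  - apply: measurable_fun_fubini_tonelli_F; last by move=> z; exact: funepos_ge0.
    exact: measurable_funepos.
  - apply: measurable_fun_fubini_tonelli_F; last by move=> z; exact: funeneg_ge0.
    exact: measurable_funeneg.
apply/funext => x; rewrite integralE; congr (_ - _)%E; congr integral;
  apply/funext => y; by rewrite ?funeposE ?funenegE.
Qed.

Lemma integrable_ae_eq d (T : measurableType d) (m : {measure set T -> \bar R})
    (D : set T) (f g : T -> \bar R) : measurable D -> measurable_fun D g ->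
  ae_eq m D f g -> m.-integrable D f -> m.-integrable D g.
Proof.
move=> mD mg fg /integrableP[mf foo]; apply/integrableP; split=> //.
rewrite (ae_eq_integral (fun x => `|f x|%E))//; try exact: measurableT_comp.
by apply: filterS fg => x /[apply] ->.
Qed.

(** For r = 0 the function h may fail to be integrable, but its real-valued integral is still a real
    number, which 0 annihilates. For r != 0 integrability of r * h passes to h. *)
Lemma RintegralZl_cond (r : R) (h : R -> R) :
  mu.-integrable setT (fun y => (r * h y)%:E) ->
  ((r * \int[mu]_y h y)%:E = \int[mu]_y (r * h y)%:E)%E.
Proof.
have [->|r0] := eqVneq r 0 => irh.
  by rewrite mul0r integral0_eq// => y _; rewrite mul0r.
have ih : mu.-integrable setT (EFin \o h).
  have := integrableZl measurableT r^-1 irh.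
  by apply: eq_integrable => // y _ /=; rewrite -EFinM mulKf.
rewrite -RintegralZl// /Rintegral fineK//.
exact: (integrable_fin_num _ irh).
Qed.

Variables (K : R * R -> R) (f g : R -> R) (M : R).
Hypothesis mK : measurable_fun setT K.
Hypothesis mg : measurable_fun setT g.
Hypothesis intf : mu.-integrable setT (EFin \o f).
Hypothesis KM : forall y, f y != 0 ->
  (\int[mu]_x (`|K (x, y)| * `|g x|)%:E <= M%:E)%E.

Let mf : measurable_fun setT f.
Proof. by move/integrableP : intf => [/measurable_EFinP]. Qed.

Let F (z : R * R) := (g z.1 * (K z * f z.2))%:E.

Let mF : measurable_fun [set: measurableTypeR R * measurableTypeR R] F.
Proof.
apply/measurable_EFinP; apply: measurable_funM.
  exact: measurableT_comp.
by apply: measurable_funM => //; exact: measurableT_comp.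
Qed.

(** Tonelli with x inside: [KM] bounds the inner integral by |M| |f y|, which is integrable. Where f
    y = 0 the inner integral vanishes, so the bound on the kernel is asked only on the support of
    f. *)
Let intF : (mu \x mu)%E.-integrable setT F.
Proof.
apply: (iffRL (@integrable21ltyP _ _ _ _ R mu mu F mF)) => /=.
have absf : (\int[mu]_y `|(f y)%:E| < +oo)%E by case/integrableP: intf.
apply: (@le_lt_trans _ _ (\int[mu]_y (`|M|%:E * `|(f y)%:E|))%E); last first.
  rewrite ge0_integralZl//; last by do 2 apply: measurableT_comp => //; exact/measurable_EFinP.
  by rewrite lte_mul_pinfty.
apply: ge0_le_integral => //.
- by move=> y _; exact: integral_ge0.
- apply: (@measurable_fun_fubini_tonelli_G _ _ (measurableTypeR R)
    (measurableTypeR R) R mu (abse \o F)) => //.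
    exact: (@measurableT_comp _ _ _ _ _ _ abse).
  by move=> z; exact: abse_ge0.
- apply: emeasurable_funM => //.
  by do 2 apply: measurableT_comp => //; exact/measurable_EFinP.
move=> y _; have [fy0|fy0] := eqVneq (f y) 0.
  rewrite integral0_eq ?mule_ge0// => x _.
  by rewrite fy0 !mulr0 normr0.
rewrite [leLHS](_ : _ = \int[mu]_x (`|(f y)%:E| * (`|K (x, y)| * `|g x|)%:E))%E; last first.
  apply: eq_integral => x _; rewrite -EFinM; congr (_%:E).
  by rewrite !normrM; ring.
rewrite ge0_integralZl//; last first.
  apply/measurable_EFinP; apply: measurable_funM; last exact: measurableT_comp.
  by apply: measurableT_comp => //; exact: measurableT_comp.
rewrite muleC lee_wpmul2r//.
by apply: le_trans (KM fy0) _; rewrite lee_fin ler_norm.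
Qed.

Lemma measurable_kernel_l : measurable_fun setT (fun x => \int[mu]_y (K (x, y) * f y)).
Proof.
apply: (@measurable_Rintegral_section (fun z => K z * f z.2)).
by apply: measurable_funM => //; exact: measurableT_comp.
Qed.

Lemma measurable_kernel_r : measurable_fun setT (fun y => \int[mu]_x (K (x, y) * g x)).
Proof.
apply: (@measurable_Rintegral_section (fun z => K (z.2, z.1) * g z.2)).
apply: measurable_funM => //; last exact: measurableT_comp.
apply: measurableT_comp => //=.
by apply/measurable_fun_pairP; split; [exact: measurable_snd|exact: measurable_fst].
Qed.

Let integrable_fubini_G' : mu.-integrable setT (fubini_G mu F).
Proof.
have mG : measurable_fun setT (fubini_G mu F) := measurable_fubini_G intF.
apply/integrableP; split=> //.
apply: le_lt_trans ((integrable21ltyP mu mu mF).1 intF).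
apply: ge0_le_integral => //.
- exact: (@measurableT_comp _ _ _ _ _ _ abse).
- apply: (@measurable_fun_fubini_tonelli_G _ _ (measurableTypeR R)
    (measurableTypeR R) R mu (abse \o F)) => //.
    exact: (@measurableT_comp _ _ _ _ _ _ abse).
  by move=> z; exact: abse_ge0.
- move=> y _; apply: le_abse_integral => //.
  exact: (measurableT_comp mF).
Qed.

(** Only almost every section of F is integrable. At the other points the left side uses the default
    value of a divergent integral, so equality can be claimed only a.e. *)
Lemma ae_kernel_l : ae_eq mu setT (fun x => (g x * \int[mu]_y (K (x, y) * f y))%:E)
  (fubini_F mu F).
Proof.
have := ae_integrable1 intF; apply: filterS => x iFx _.
exact: (@RintegralZl_cond (g x) (fun y => K (x, y) * f y) iFx).
Qed.

Lemma ae_kernel_r : ae_eq mu setT (fun y => (f y * \int[mu]_x (K (x, y) * g x))%:E)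
  (fubini_G mu F).
Proof.
have := ae_integrable2 intF; apply: filterS => y iFy _.
have FE x : F (x, y) = (f y * (K (x, y) * g x))%:E by rewrite /F/=; congr (_%:E); ring.
rewrite /fubini_G; under [RHS]eq_integral do rewrite FE.
apply: RintegralZl_cond; apply: eq_integrable iFy => // x _; exact: FE.
Qed.

Lemma integrable_kernel_l :
  mu.-integrable setT (fun x => (g x * \int[mu]_y (K (x, y) * f y))%:E).
Proof.
have := integrable_fubini_F intF; apply: integrable_ae_eq => //.
  by apply/measurable_EFinP/measurable_funM => //; exact: measurable_kernel_l.
exact/ae_eq_sym/ae_kernel_l.
Qed.

Lemma integrable_kernel_r :
  mu.-integrable setT (fun y => (f y * \int[mu]_x (K (x, y) * g x))%:E).
Proof.
have := integrable_fubini_G'; apply: integrable_ae_eq => //.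
  by apply/measurable_EFinP/measurable_funM => //; exact: measurable_kernel_r.
exact/ae_eq_sym/ae_kernel_r.
Qed.

Lemma kernel_fubini : \int[mu]_x (g x * \int[mu]_y (K (x, y) * f y)) =
  \int[mu]_y (f y * \int[mu]_x (K (x, y) * g x)).
Proof.
congr fine.
transitivity (\int[mu]_x \int[mu]_y F (x, y))%E.
  apply: ae_eq_integral => //.
  - exact: (measurable_int _ integrable_kernel_l).
  - exact: (measurable_int _ (integrable_fubini_F intF)).
  - exact: ae_kernel_l.
rewrite (Fubini intF); apply/esym; apply: ae_eq_integral => //.
- exact: (measurable_int _ integrable_kernel_r).
- exact: (measurable_int _ (integrable_fubini_G')).
- exact: ae_kernel_r.
Qed.

End kernel_fubini.

(** * The one-sided power kernel and its integrability *)

Section power_kernel.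
Context {R : realType}.
Local Notation mu := (@lebesgue_measure R).

(* With e = 1 on the left and e = -1 on the right, the two fractional integrals
   on ]a, b[ are the convolutions of f \_ ]a, b[ with t |-> pker s (e * t),
   divided by Gamma s. *)
Definition pker (s t : R) : R := if 0 < t then t `^ (s - 1) else 0.

Lemma pker_ge0 s t : 0 <= pker s t.
Proof. by rewrite /pker; case: ifP => // _; exact: powR_ge0. Qed.

Lemma measurable_pker s : measurable_fun setT (pker s).
Proof.
apply: measurable_fun_ifT; [exact: measurable_fun_ltr|exact: measurable_powR|].
exact: measurable_cst.
Qed.

Lemma pker_scale s (c t : R) : 0 < c -> pker s (c * t) = c `^ (s - 1) * pker s t.
Proof.
move=> c0; rewrite /pker pmulr_rgt0//; case: ifPn => t0; last by rewrite mulr0.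
by rewrite powRM// ltW.
Qed.

Lemma integral_powR_itvcc (s x y : R) : 0 < s -> 0 < x -> x < y ->
  (\int[mu]_(t in `[x, y]) (t `^ (s - 1))%:E = ((y `^ s - x `^ s) / s)%:E)%E.
Proof.
move=> s0 x0 xy.
have d (r : R) : 0 < r ->
    is_derive r 1 (fun t => s^-1 * t `^ s) (r `^ (s - 1)).
  move=> r0; have h := is_derive1_powR s r0.
  by apply: is_derive_eq; rewrite /GRing.scale/= mulrA mulVf ?gt_eqF// mul1r.
have c (r : R) : 0 < r -> {for r, continuous (fun t => s^-1 * t `^ s)}.
  move=> r0; apply: differentiable_continuous; apply/derivable1_diffP.
  by have [] := d _ r0.
rewrite (@continuous_FTC2 _ _ (fun t => s^-1 * t `^ s))//.
- by rewrite -EFinB; congr (_%:E); ring.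
- apply: derivable_within_continuous => t; rewrite in_itv/= => /andP[xt _].
  by have [] := is_derive1_powR (s - 1) (lt_le_trans x0 xt).
- split.
  + move=> t; rewrite in_itv/= => /andP[xt _].
    by have [] := d _ (lt_trans x0 xt).
  + exact/cvg_at_right_filter/c.
  + exact/cvg_at_left_filter/c/(lt_trans x0).
- move=> t; rewrite in_itv/= => /andP[xt _].
  have h := d _ (lt_trans x0 xt).
  by rewrite derive1E derive_val.
Qed.

(** The singularity at 0 is approached by the intervals [L/(n+2), L]: on each one the antiderivative
    t^s/s bounds the integral by L^s/s, and monotone convergence passes to the limit. *)
Lemma integral_pker_lty (s L : R) : 0 < s ->
  (\int[mu]_(t in `]-oo, L[) (pker s t)%:E < +oo)%E.
Proof.
move=> s0; have [L0|L0] := leP L 0.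
  rewrite integral0_eq// => t /=; rewrite in_itv/= => tL.
  by rewrite /pker ltNge (le_trans (ltW tL) L0).
have mpk D : measurable_fun D (fun t => (pker s t)%:E).
  by apply/measurable_EFinP; apply: measurable_funTS; exact: measurable_pker.
have -> : `]-oo, L[%classic = `]-oo, 0%R] `|` (`]0, L[%classic : set R).
  apply/seteqP; split => t /=; rewrite !in_itv/=.
    by move=> ->; rewrite andbT; apply/orP; rewrite leNgt; case: (0 < t).
  by move=> [/le_lt_trans|/andP[]//]; exact.
rewrite ge0_integral_setU//=; last 3 first.
- exact: mpk.
- by move=> t _; rewrite lee_fin pker_ge0.
- apply/disj_setPS => t [/=]; rewrite !in_itv/= => t0 /andP[].
  by rewrite ltNge t0.
rewrite integral0_eq ?add0e; last first.
  by move=> t /=; rewrite in_itv/= => t0; rewrite /pker ltNge t0.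
(* The denominator starts at 2 so that the left end is strictly below L and the interval is never
   degenerate. *)
pose F n : set R := `[L / n.+2%:R, L]%classic.
have FE : `]0, L[%classic `<=` \bigcup_n F n.
  move=> t /=; rewrite in_itv/= => /andP[t0 tL].
  have [n] := ltr_add_invr (divr_gt0 t0 L0); rewrite add0r => nt.
  exists n => //; rewrite /F/= in_itv/= (ltW tL) andbT.
  rewrite mulrC -ler_pdivlMr// (le_trans _ (ltW nt))//.
  by rewrite lef_pV2 ?posrE// ler_nat.
have F0 n t : F n t -> 0 < t.
  by rewrite /F/= in_itv/= => /andP[+ _]; apply: lt_le_trans; rewrite divr_gt0.
apply: (@le_lt_trans _ _ (L `^ s / s)%:E); last exact: ltry.
apply: (@le_trans _ _ (\int[mu]_(t in \bigcup_n F n) (pker s t)%:E)%E).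
  apply: ge0_subset_integral => //.
  - by apply: bigcup_measurable => n _; exact: measurable_itv.
  - exact: mpk.
  - by move=> t _; rewrite lee_fin pker_ge0.
have ndF : {homo F : n m / (n <= m)%N >-> (n <= m)%O}.
  move=> n m nm; apply/subsetPset => t; rewrite /F/= !in_itv/= => /andP[nt ->].
  rewrite andbT (le_trans _ nt)// ler_pM2l// lef_pV2 ?posrE// ler_nat.
  by rewrite !ltnS.
have cv : (\int[mu]_(t in F n) (pker s t)%:E)%E @[n --> \oo] -->
    (\int[mu]_(t in \bigcup_n F n) (pker s t)%:E)%E.
  apply: ge0_nondecreasing_set_cvg_integral => // [n|n|n t _].
  - exact: measurable_itv.
  - exact: mpk.
  - by rewrite lee_fin pker_ge0.
rewrite -(cvg_lim _ cv)//; apply: lime_le.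
  by apply/cvg_ex; eexists; exact: cv.
apply: nearW => n.
rewrite [leLHS](_ : _ = \int[mu]_(t in `[(L / n.+2%:R)%R, L]) (t `^ (s - 1))%:E)%E; last first.
  by apply: eq_integral => t /set_mem/F0 t0; rewrite /pker t0.
rewrite integral_powR_itvcc// ?divr_gt0//; last first.
  by rewrite ltr_pdivrMr// ltr_pMr// ltr1n.
by rewrite lee_fin ler_pM2r ?invr_gt0// gerBl powR_ge0.
Qed.

(** Substitute x = e t + y: with y in [a, b], the point x lies in ]a, b[ only if t < b - a. The
    bound does not depend on y, which is what the Fubini argument requires. *)
Lemma integral_pker_le (s a b y e : R) : `|e| = 1 -> a <= y <= b ->
  (\int[mu]_x (pker s (e * (x - y)) * \1_(`]a, b[) x)%:E <=
   \int[mu]_(t in `]-oo, (b - a)%R[) (pker s t)%:E)%E.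
Proof.
move=> e1 /andP[ay yb]; have ee : e * e = 1.
  by rewrite -expr2 -real_normK ?num_real// e1 expr1n.
have mp : measurable_fun setT (fun x : R => (pker s (e * (x - y)) * \1_(`]a, b[) x)%:E).
  apply/measurable_EFinP; apply: measurable_funM => //.
  apply: measurableT_comp; first exact: measurable_pker.
  by apply: measurable_funM => //; exact: measurable_funB.
rewrite (integral_affine1 y e1 mp) [leRHS]integral_mkcond.
apply: ge0_le_integral => //.
- by move=> t _; rewrite lee_fin mulr_ge0 ?pker_ge0.
- apply: (measurableT_comp mp); exact: measurable_affine.
- apply/(measurable_restrictT _ _).1 => //.
  by apply/measurable_EFinP; apply: measurable_funTS; exact: measurable_pker.
move=> t _; rewrite addrK mulrA ee mul1r patchE; case: ifPn => tL.
  by rewrite lee_fin ler_piMr ?pker_ge0// indicE lern1 leq_b1.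
rewrite [leRHS](_ : _ = 0%E)// lee_fin /pker; case: ifPn => t0; last by rewrite mul0r.
rewrite indicE memNset ?mulr0//= in_itv/= => /andP[at1 tb].
move: tL; rewrite notin_setE/= in_itv/=; apply.
move/eqP: e1; rewrite eqr_norml => /andP[/orP[/eqP eE|/eqP eE] _];
  by move: at1 tb; rewrite eE; lra.
Qed.

End power_kernel.

(** * The Gamma function on ]0, 1] and the Beta integral B(al, 1 - al) *)

Section gamma_beta.
Context {R : realType}.
Local Notation mu := (@lebesgue_measure R).

Lemma integral_expRN : (\int[mu]_(t in `[0%R, +oo[) (expR (- t))%:E = 1)%E.
Proof.
rewrite -(@integral_exponential_pdf R 1)// integral_mkcond.
apply: eq_integral => t _; rewrite /exponential_pdf/= !patchE; case: ifP => // _.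
by rewrite mul1r mulN1r.
Qed.

Let meas_exp : measurable_fun setT (fun t : R => expR (- t)).
Proof. by apply: measurableT_comp => //; exact: measurable_oppr. Qed.

(** Finiteness is the point. Below 1 the integrand is at most the kernel, integrable there; from 1
    on, s <= 1 gives t^(s-1) <= 1, and the exponential dominates. *)
Lemma integral_gamma (s : R) : 0 < s <= 1 ->
  (\int[mu]_t (pker s t * expR (- t))%:E = (Gamma s)%:E)%E.
Proof.
move=> /andP[s0 s1]; have mpe : measurable_fun setT (fun t : R => (pker s t * expR (- t))%:E).
  apply/measurable_EFinP; apply: measurable_funM => //; exact: measurable_pker.
have -> : Gamma s = fine (\int[mu]_t (pker s t * expR (- t))%:E).
  rewrite /Gamma /Rintegral; congr fine; rewrite integral_mkcond.
  apply: eq_integral => t _; rewrite patchE /pker mem_setE in_itv/= andbT.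
  by case: ifP => //; rewrite mul0r.
rewrite fineK// ge0_fin_numE; last first.
  by apply: integral_ge0 => t _; rewrite lee_fin mulr_ge0 ?pker_ge0 ?expR_ge0.
have mp D : measurable_fun D (fun t : R => (pker s t)%:E).
  by apply/measurable_EFinP; apply: measurable_funTS; exact: measurable_pker.
have me D : measurable_fun D (fun t : R => (expR (- t))%:E).
  by apply/measurable_EFinP; apply: measurable_funTS.
have mD1 : measurable_fun setT ((fun t : R => (pker s t)%:E) \_ `]-oo, 1[).
  by apply/(measurable_restrictT _ _).1.
have mD2 : measurable_fun setT ((fun t : R => (expR (- t))%:E) \_ `[0, +oo[).
  by apply/(measurable_restrictT _ _).1.
pose G1 := (fun t : R => (pker s t)%:E) \_ `]-oo, 1[.
pose G2 := (fun t : R => (expR (- t))%:E) \_ `[0, +oo[.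
apply: (@le_lt_trans _ _ (\int[mu]_t (G1 t + G2 t)%E)%E).
  apply: ge0_le_integral => //.
  - by move=> t _; rewrite lee_fin mulr_ge0 ?pker_ge0 ?expR_ge0.
  - exact: emeasurable_funD.
  move=> t _; rewrite /G1 /G2 !patchE !mem_setE !in_itv/= andbT.
  have [t0|t0] := ltP 0 t; last first.
    rewrite /pker ltNge t0/= mul0r adde_ge0//.
      by case: ifP => // _; rewrite lee_fin.
    by case: ifP => // _; rewrite lee_fin expR_ge0.
  rewrite (ltW t0) /pker t0; case: ifPn => t1.
    rewrite -EFinD lee_fin; apply: ler_wpDr; first exact: expR_ge0.
    by rewrite ler_piMr ?powR_ge0// expR_le1 oppr_le0 ltW.
  rewrite [X in (_ <= X + _)%E](_ : _ = 0%E)// add0e lee_fin ler_piMl ?expR_ge0//.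
  rewrite -leNgt in t1.
  by rewrite -[leRHS](powRr0 t) ler_powR// subr_le0.
rewrite [ltLHS](_ : _ = (\int[mu]_t G1 t + \int[mu]_t G2 t)%E); last first.
  apply: ge0_integralD => // t _; apply: erestrict_ge0 => u _; rewrite lee_fin.
  - exact: pker_ge0.
  - exact: expR_ge0.
rewrite -!integral_mkcond integral_expRN lte_add_pinfty ?ltry//.
exact: integral_pker_lty.
Qed.

(** For t > 0 this is the Beta integral B(al, 1 - al), written as a convolution of kernels. *)
Let conv (al t : R) : \bar R := (\int[mu]_x (pker al (t - x) * pker (1 - al) x)%:E)%E.

Let mpp (al : R) : measurable_fun [set: measurableTypeR R * measurableTypeR R]
  (fun z : R * R => pker al (z.1 - z.2) * pker (1 - al) z.2).
Proof.
apply: measurable_funM; apply: measurableT_comp => //; try exact: measurable_pker.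
exact: measurable_funB.
Qed.

(** Substituting x -> t x, the kernels contribute t^(al-1) t^(-al) = 1/t, which the Jacobian t
    cancels. *)
Lemma pker_conv_scale (al t : R) : 0 < t -> conv al t = conv al 1.
Proof.
move=> t0; have m1 : measurable_fun setT (fun x : R => (pker al (t - x) * pker (1 - al) x)%:E).
  apply/measurable_EFinP; apply: measurable_funM; last exact: measurable_pker.
  apply: measurableT_comp; first exact: measurable_pker.
  exact: measurable_funB.
rewrite {1}/conv (@ge0_integral_affine _ t 0)//; last 2 first.
- by rewrite gt_eqF.
- by move=> x; rewrite lee_fin mulr_ge0 ?pker_ge0.
have -> : (fun x : R => (pker al (t - (t * x + 0)) * pker (1 - al) (t * x + 0))%:E) =
    fun x => ((t^-1)%:E * (pker al (1 - x) * pker (1 - al) x)%:E)%E.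
  apply/funext => x; rewrite addr0 -{1}(mulr1 t) -mulrBr !pker_scale//.
  rewrite -EFinM mulrACA; congr (_ * _)%:E.
  rewrite -powRD; last by apply/implyP => _; exact: lt0r_neq0.
  by rewrite (_ : _ + _ = -1) ?powR_inv1 ?ltW//; ring.
rewrite ge0_integralZl//.
- by rewrite muleA -EFinM gtr0_norm// divff ?gt_eqF// mul1e.
- apply/measurable_EFinP; apply: measurable_funM; last exact: measurable_pker.
  apply: measurableT_comp; first exact: measurable_pker.
  exact: measurable_funB.
- by move=> x _; rewrite lee_fin mulr_ge0 ?pker_ge0.
- by rewrite lee_fin invr_ge0 ltW.
Qed.

Lemma pker_conv_le0 (al t : R) : t <= 0 -> conv al t = 0%E.
Proof.
move=> t0; apply: integral0_eq => x _; rewrite /pker.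
have [x0|x0] := ltP 0 x; last by rewrite mulr0.
by rewrite ltNge (_ : t - x <= 0) ?mul0r//; lra.
Qed.

(* The two orders of integration of exp(-x) (x - y)^(al - 1) y^(-al), 0 < y < x. *)
Lemma gamma_gammaE (al : R) : 0 < al < 1 ->
  conv al 1 = (Gamma al * Gamma (1 - al))%:E.
Proof.
move=> /andP[al0 al1].
have G1 : (\int[mu]_t (pker al t * expR (- t))%:E = (Gamma al)%:E)%E.
  by apply: integral_gamma; rewrite al0 ltW.
have G2 : (\int[mu]_t (pker (1 - al) t * expR (- t))%:E = (Gamma (1 - al))%:E)%E.
  by apply: integral_gamma; lra.
pose F (z : R * R) := (expR (- z.1) * (pker al (z.1 - z.2) * pker (1 - al) z.2))%:E.
have F0 z : (0 <= F z)%E by rewrite lee_fin !mulr_ge0 ?pker_ge0 ?expR_ge0.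
have mF : measurable_fun [set: measurableTypeR R * measurableTypeR R] F.
  apply/measurable_EFinP; apply: measurable_funM; last exact: mpp.
  exact: (measurableT_comp meas_exp).
have c0 : (0 <= conv al 1)%E.
  by apply: integral_ge0 => x _; rewrite lee_fin mulr_ge0 ?pker_ge0.
have mconv t : measurable_fun setT (fun x : R => (pker al (t - x) * pker (1 - al) x)%:E).
  apply/measurable_EFinP; apply: measurable_funM; last exact: measurable_pker.
  apply: measurableT_comp; first exact: measurable_pker.
  exact: measurable_funB.
(* With y inside, the inner integral is exp(-x) times a convolution that is the same for all x > 0,
   and exp(-x) has mass 1 on the half-line. *)
have E1 : (\int[mu]_x \int[mu]_y F (x, y) = conv al 1)%E.
  transitivity (\int[mu]_(x in `]0%R, +oo[) ((expR (- x))%:E * conv al 1))%E.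
    rewrite [RHS]integral_mkcond; apply: eq_integral => x _; rewrite patchE.
    rewrite mem_setE in_itv/= andbT /F/=.
    under eq_integral do rewrite EFinM.
    rewrite ge0_integralZl//.
    - case: ifPn => x0; first by rewrite -(pker_conv_scale al x0).
      rewrite -/(conv al x) pker_conv_le0 ?mule0//; first by rewrite leNgt.
    - exact: mconv.
    - by move=> y _; rewrite lee_fin mulr_ge0 ?pker_ge0.
  rewrite ge0_integralZr//.
  - rewrite integral_itv_obnd_cbnd ?integral_expRN ?mul1e//.
    by apply/measurable_EFinP; apply: measurable_funTS.
  - by apply/measurable_EFinP; apply: measurable_funTS.
have E2 : (\int[mu]_y \int[mu]_x F (x, y) = (Gamma al * Gamma (1 - al))%:E)%E.
  transitivity (\int[mu]_y ((pker (1 - al) y * expR (- y))%:E * (Gamma al)%:E))%E.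
    apply: eq_integral => y _; rewrite -G1 -ge0_integralZl//.
    - rewrite (@integral_affine1 _ 1 y) ?normr1//.
        apply: eq_integral => x _; rewrite /F/= mul1r addrK -EFinM; congr (_%:E).
        by rewrite opprD expRD; ring.
      exact: (measurableT_comp mF).
    - apply/measurable_EFinP; apply: measurable_funM => //; exact: measurable_pker.
    - by move=> x _; rewrite lee_fin mulr_ge0 ?pker_ge0 ?expR_ge0.
    - by rewrite lee_fin mulr_ge0 ?pker_ge0 ?expR_ge0.
  rewrite ge0_integralZr//.
  - by rewrite G2 -EFinM mulrC.
  - apply/measurable_EFinP; apply: measurable_funM => //; exact: measurable_pker.
  - by move=> x _; rewrite lee_fin mulr_ge0 ?pker_ge0 ?expR_ge0.
  - rewrite -G1; apply: integral_ge0 => x _.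
    by rewrite lee_fin mulr_ge0 ?pker_ge0 ?expR_ge0.
exact: etrans (esym E1) (etrans (@fubini_tonelli _ _ _ _ R mu mu F mF F0) E2).
Qed.

(** Both kernels are at least 1 on ]0, 1[, so the Beta integral, which equals Gamma(al) Gamma(1 -
    al), is at least 1. Hence Gamma(al), already nonnegative, cannot vanish. *)
Lemma gamma_gt0 (al : R) : 0 < al < 1 -> 0 < Gamma al.
Proof.
move=> al01; have /andP[al0 al1] := al01.
have Gge0 (s : R) : 0 <= Gamma s.
  by apply: Rintegral_ge0 => t _; rewrite mulr_ge0 ?powR_ge0 ?expR_ge0.
have : (1%:E <= conv al 1)%E.
  apply: (@le_trans _ _ (\int[mu]_x (\1_(`]0, 1[) x)%:E)%E).
    by rewrite integral_indic//= setIT lebesgue_measure_itv/= lte_fin ltr01 sube0.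
  apply: ge0_le_integral => //.
  - by apply/measurable_EFinP.
  - apply/measurable_EFinP; apply: measurable_funM; last exact: measurable_pker.
    apply: measurableT_comp; first exact: measurable_pker.
    exact: measurable_funB.
  move=> x _; rewrite lee_fin indicE mem_setE in_itv/=.
  have [/andP[x0 x1]|_] := boolP (0 < x < 1); last by rewrite mulr_ge0 ?pker_ge0.
  have p (s y : R) : s < 1 -> 0 < y < 1 -> 1 <= pker s y.
    move=> s1 /andP[y0 y1]; rewrite /pker y0.
    rewrite -[leLHS]invr1 -[s - 1]opprK powRN lef_pV2 ?posrE ?powR_gt0//.
    have := @ge0_ler_powR R (- (s - 1)); rewrite oppr_ge0 subr_le0 => /(_ (ltW s1)).
    move=> /(_ y 1); rewrite !nnegrE powR1; apply => //; exact: ltW.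
  apply: (@le_trans _ _ (1 * 1)); first by rewrite mulr1.
  by apply: ler_pM => //; apply: p; lra.
rewrite gamma_gammaE// lee_fin => G1.
by rewrite lt_neqAle Gge0 andbT; apply: contraTneq G1 => <-; rewrite mul0r -ltNge.
Qed.

Lemma pker1 (t : R) : pker 1 t = (0 < t)%R%:R.
Proof. by rewrite /pker subrr powRr0; case: (0 < t). Qed.

(** The semigroup law at the level of kernels, for both directions at once; [pker 1] is the
    Heaviside function. *)
Lemma integral_pker_conv (al e y z : R) : 0 < al < 1 -> `|e| = 1 ->
  (\int[mu]_x (pker al (e * (z - x)) * pker (1 - al) (e * (x - y)))%:E =
   (Gamma al * Gamma (1 - al) * pker 1 (e * (z - y)))%:E)%E.
Proof.
move=> al01 e1; have ee : e * e = 1.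
  by rewrite -expr2 -real_normK ?num_real// e1 expr1n.
rewrite (integral_affine1 y e1); last first.
  apply/measurable_EFinP; apply: measurable_funM;
    apply: measurableT_comp; try exact: measurable_pker;
    by apply: measurable_funM => //; exact: measurable_funB.
transitivity (conv al (e * (z - y))).
  apply: eq_integral => t _; rewrite addrK mulrA ee mul1r.
  have -> : e * (z - (e * t + y)) = e * (z - y) - e * e * t by ring.
  by rewrite ee mul1r.
rewrite pker1; have [t0|t0] := ltP 0 (e * (z - y)).
  by rewrite (pker_conv_scale _ t0) gamma_gammaE// mulr1.
by rewrite pker_conv_le0// mulr0.
Qed.

End gamma_beta.

(** * Smooth functions and the flat function exp(-1/x) *)

Section smooth.
Context {R : realType}.

(** An explicit chain of derivatives, instead of iterates of the total derivative operator, lets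
    closure under sums, products and affine substitution follow by induction from the rules for one
    derivative. *)
Fixpoint Cn (n : nat) (f : R -> R) : Prop :=
  if n is n'.+1 then
    exists2 g, (forall x : R, is_derive x 1 f (g x)) & Cn n' g
  else True.

Definition smooth (f : R -> R) := forall n, Cn n f.

Lemma CnS n f : Cn n.+1 f -> Cn n f.
Proof.
by elim: n f => [//|n IHn] f [g fg Cg]; exists g => //; exact: IHn.
Qed.

Lemma smooth_derivable f : smooth f -> forall n (x : R), derivable (f^`(n))%classic x 1.
Proof.
move=> sf n; have := sf n.+1; elim: n f {sf} => [|n IHn] f [g fg Cg] x.
  by have [] := fg x.
rewrite derive1Sn (_ : f^`()%classic = g); first exact: IHn.
by apply/funext => y; rewrite derive1E; exact: derive_val.
Qed.

Lemma Cn_cst n (c : R) : Cn n (fun=> c).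
Proof.
elim: n c => [//|n IHn] c; exists (fun=> 0); last exact: IHn.
by move=> x; exact: is_derive_cst.
Qed.

Lemma CnD n f g : Cn n f -> Cn n g -> Cn n (fun x => f x + g x).
Proof.
elim: n f g => [//|n IHn] f g [f' ff' Cf'] [g' gg' Cg'].
exists (fun x => f' x + g' x); last exact: IHn.
move=> x; have h1 := ff' x; have h2 := gg' x; exact: is_deriveD.
Qed.

Lemma CnM n f g : Cn n f -> Cn n g -> Cn n (fun x => f x * g x).
Proof.
elim: n f g => [//|n IHn] f g Cf Cg.
have [f' ff' Cf'] := Cf; have [g' gg' Cg'] := Cg.
exists (fun x => f x * g' x + g x * f' x).
  by move=> x; have h1 := ff' x; have h2 := gg' x; exact: is_deriveM.
by apply: CnD; apply: IHn => //; exact: CnS.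
Qed.

Lemma Cn_affine n f (c d : R) : Cn n f -> Cn n (fun x => f (c * x + d)).
Proof.
elim: n f => [//|n IHn] f [g fg Cg].
exists (fun x => c * g (c * x + d)); last by apply: CnM; [exact: Cn_cst|exact: IHn].
move=> x; have h := fg (c * x + d).
have -> : (fun x => f (c * x + d)) = f \o (fun x => c * x + d) by [].
have hl : is_derive x 1 (fun x => c * x + d) c.
  by apply: is_derive_eq; rewrite addr0 /GRing.scale/= mulr1.
apply: is_derive_eq (@is_derive1_comp _ f (fun x => c * x + d) x _ _ h hl) _.
exact: mulrC.
Qed.

(** The flat function is the case m = 0. The powers x^(-m) are included because the span of the
    family is closed under differentiation, so one induction proves all its members smooth. *)
Definition expinv (m : nat) (x : R) : R := if 0 < x then x ^- m * expR (- x^-1) else 0.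

(** The exponential at 1/x dominates the term of degree m + 1 of its series. A bound linear in x is
    what the difference quotient at 0 needs. *)
Lemma expinv_bound (m : nat) (x : R) : 0 < x ->
  x ^- m * expR (- x^-1) <= (m.+1)`!%:R * x.
Proof.
move=> x0; have := expR_ge1Dxn m (ltW (_ : 0 < x^-1)); rewrite invr_gt0 => /(_ x0) h.
rewrite expRN ler_pdivrMr ?expR_gt0//.
have : (m.+1)`!%:R * x * (x^-1 ^+ m.+1 / (m.+1)`!%:R) <= (m.+1)`!%:R * x * expR x^-1.
  rewrite ler_pM2l ?mulr_gt0 ?ltr0n ?fact_gt0//; apply: le_trans h; lra.
apply: le_trans; rewrite exprS exprVn.
rewrite [leRHS](_ : _ = ((m.+1)`!%:R / (m.+1)`!%:R) * (x / x) * x ^- m); last by ring.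
by rewrite !divff ?mul1r ?gt_eqF// pnatr_eq0 -lt0n fact_gt0.
Qed.

Lemma is_derive_expinv (m : nat) (x : R) :
  is_derive x 1 (expinv m) (expinv m.+2 x - m%:R * expinv m.+1 x).
Proof.
have [x0|x0|->] := ltgtP x 0.
- rewrite /expinv !ltNge (ltW x0)/= mulr0 subr0.
  apply: near_eq_is_derive (is_derive_cst 0 x 1).
  near=> y; rewrite /cst/= ifF//; apply/negbTE.
  by rewrite -leNgt ltW//; near: y; exact: lt_nbhsl.
- rewrite {2 3}/expinv x0.
  pose f y : R := (y^-1) ^+ m * expR (- y^-1).
  apply: (@near_eq_is_derive _ _ _ f).
    near=> y; rewrite /f /expinv ifT ?exprVn//; near: y; exact: lt_nbhsr.
  have hV : is_derive x 1 (fun y : R => y^-1) (- x ^- 2).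
    have hid : is_derive x 1 (@id R) 1 := is_derive_id x 1.
    have := @is_deriveV _ id x _ _ (lt0r_neq0 x0) hid.
    by rewrite /GRing.scale/= mulr1.
  have hX := is_deriveX m hV.
  have hN := is_deriveN hV.
  have hE : is_derive x 1 (fun y => expR (- y^-1)) (expR (- x^-1) * x ^- 2).
    have := @is_derive1_comp _ expR (- (fun y : R => y^-1)) x _ _ (is_derive_expR _) hN.
    by rewrite opprK.
  have hM := is_deriveM hX hE.
  have fE : f = (fun y : R => y^-1) ^+ m * (fun y => expR (- y^-1)).
    by apply/funext => y; rewrite /f !fctE.
  rewrite fE; apply: is_derive_eq hM _; rewrite /GRing.scale/= !fctE.
  clear; case: m => [|m].
    by rewrite !mul0r mulr0 subr0 addr0 expr0 mul1r mulrC.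
  by rewrite -!exprVn !exprS; ring.
- rewrite /expinv ltxx mulr0 subr0 -/(expinv m).
  (* For h > 0 the quotient is h^(-m-1) exp(-1/h), at most (m+2)! h by the bound at m + 1; for h < 0
     it is 0. *)
  have cv : h^-1 *: (expinv m (h *: 1 + 0) - expinv m 0) @[h --> 0^'] --> 0.
    apply/cvgr0Pnorm_lt => e e0.
    have C0 : (0 : R) < (m.+2)`!%:R by rewrite ltr0n fact_gt0.
    near=> h; rewrite addr0 /GRing.scale/= mulr1 /expinv ltxx subr0.
    have h0 : h != 0 by near: h; exact: nbhs_dnbhs_neq.
    case: ifPn => [hp|_]; last by rewrite mulr0 normr0.
    rewrite mulrA -invfM -exprS ger0_norm; last first.
      by rewrite mulr_ge0 ?expR_ge0// invr_ge0 exprn_ge0// ltW.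
    apply: le_lt_trans (expinv_bound m.+1 hp) _.
    rewrite mulrC -ltr_pdivlMr// -(gtr0_norm hp); near: h.
    by apply: dnbhs0_lt; rewrite divr_gt0.
  by apply: DeriveDef; [apply/cvg_ex; exists 0|apply/cvg_lim].
Unshelve. all: by end_near. Qed.

Lemma smooth_expinv m : smooth (expinv m).
Proof.
move=> n; elim: n m => [//|n IHn] m.
eexists; first exact: is_derive_expinv.
apply: CnD; first exact: IHn.
have -> : (fun x => - (m%:R * expinv m.+1 x)) = (fun x => (- m%:R) * expinv m.+1 x).
  by apply/funext => x; rewrite mulNr.
by apply: CnM; [exact: Cn_cst|exact: IHn].
Qed.

End smooth.

(** * Construction of test functions, and vanishing from constant primitives *)

Section test_functions.
Context {R : realType}.
Local Notation mu := (@lebesgue_measure R).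

(** By Lebesgue differentiation H is a.e. the derivative of its primitive, which is constant near
    each point of ]a, b[. *)
Lemma ae_eq0_Rintegral (H : R -> R) (a b k : R) :
  mu.-integrable setT (EFin \o H) ->
  (forall z, a < z < b -> \int[mu]_(x in `]-oo, z]) H x = k) ->
  {ae mu, forall x, `]a, b[%classic x -> H x = 0}.
Proof.
move=> iH Hk.
have lH : locally_integrable setT H.
  by apply: open_integrable_locally => //; exact: openT.
have iHy y : mu.-integrable [set` Interval -oo%O (BRight y)] (EFin \o H).
  exact: integrableS iH.
have := FTC1 iHy lH; apply: filterS; first exact: (ae_filter_ringOfSetsType mu).
move=> x /= + abx.
move=> /(_ (ltNyr _)) [_ <-].
rewrite derive1E (@near_eq_derive _ _ _ _ (cst k)) ?derive_cst//.
move: abx; rewrite in_itv/= => /andP[ax xb].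
near=> y; apply: Hk; apply/andP; split.
  by near: y; exact: lt_nbhsr.
by near: y; exact: lt_nbhsl.
Unshelve. all: by end_near. Qed.

Lemma smooth_continuous (f : R -> R) : smooth f -> continuous f.
Proof.
move=> sf x; apply/differentiable_continuous/derivable1_diffP.
exact: (@smooth_derivable _ f sf 0%N x).
Qed.

Lemma integrable_smooth (f : R -> R) (c d : R) : smooth f ->
  (forall x, f x != 0 -> c <= x <= d) -> mu.-integrable setT (EFin \o f).
Proof.
move=> sf fcd.
have -> : EFin \o f = (EFin \o f) \_ `[c, d].
  apply/funext => x; rewrite patchE mem_setE in_itv/=; case: ifPn => // /negP cd.
  by have [->|/fcd//] := eqVneq (f x) 0.
rewrite -integrable_mkcond//.
apply: continuous_compact_integrable; first exact: segment_compact.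
exact/continuous_subspaceT/smooth_continuous.
Qed.

(** The primitive from -oo vanishes to the left of c because f does, and to the right of d because
    it has reached the total integral 0; its support is thus inside [c, d]. *)
Lemma primitive_test_function (f : R -> R) (a b c d : R) : a < c -> d < b ->
  smooth f -> (forall x, f x != 0 -> c <= x <= d) -> \int[mu]_x f x = 0 ->
  exists2 phi : R -> R, test_function `]a, b[ phi & phi^`()%classic = f.
Proof.
move=> ac db sf fcd f0; pose phi x := \int[mu]_(t in `]-oo, x]) f t.
have intf := integrable_smooth sf fcd.
have dphi (x : R) : derivable phi x 1 /\ phi^`()%classic x = f x.
  apply: (@continuous_FTC1 _ _ _ _ (x + 1)); rewrite ?ltrDl ?ltNyr//.
    exact: integrableS intf.
  exact: smooth_continuous.
have dE : phi^`()%classic = f by apply/funext => x; case: (dphi x).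
have sphi : smooth phi.
  case=> [//|n]; exists f; last exact: sf.
  move=> x; have [h1 h2] := dphi x; apply: DeriveDef; first exact: h1.
  by rewrite -derive1E; exact: h2.
have supp : [set x | phi x != 0] `<=` `[c, d].
  move=> x /=; rewrite in_itv/=; apply: contraNT; rewrite negb_and -!ltNge.
  move=> /orP[xc|dx]; apply/eqP.
    rewrite /phi Rintegral_mkcond (_ : _ \_ _ = cst 0) ?Rintegral_cst ?mul0r//.
    apply/funext => t; rewrite patchE mem_setE in_itv/=; case: ifPn => // tx.
    have [//|/fcd] := eqVneq (f t) 0.
    by move=> /andP[/(lt_le_trans xc)]; rewrite ltNge tx.
  rewrite -[RHS]f0 /phi Rintegral_mkcond; congr Rintegral; apply/funext => t.
  rewrite patchE mem_setE in_itv/=; case: ifPn => //; rewrite -ltNge => xt.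
  have [//|/fcd] := eqVneq (f t) 0.
  by move=> /andP[_ /le_lt_trans/(_ dx)]; rewrite ltNge (ltW xt).
have csupp : closure [set x | phi x != 0] `<=` `[c, d].
  have cl : closed (`[c, d] : set R) by exact: itv_closed.
  by move: cl => /closure_id ->; exact: closure_subset.
exists phi; [split|exact: dE]; first exact: smooth_derivable.
  apply: subclosed_compact csupp; first exact: closed_closure.
  exact: segment_compact.
apply: subset_trans csupp _ => x /=; rewrite !in_itv/= => /andP[cx xd].
by rewrite (lt_le_trans ac cx) (le_lt_trans xd db).
Qed.

Lemma expinv0_ge0 (x : R) : 0 <= expinv 0 x.
Proof. by rewrite /expinv; case: ifP => // _; rewrite expr0 invr1 mul1r expR_ge0. Qed.

Lemma expinv0_le1 (x : R) : expinv 0 x <= 1.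
Proof.
rewrite /expinv; case: ifPn => // x0.
by rewrite expr0 invr1 mul1r expR_le1 oppr_le0 invr_ge0 ltW.
Qed.

(** For every k > 0 it is nonzero exactly on ]c, d[ and at most 1. The factor k sharpens it: as k
    grows it tends pointwise to the indicator of ]c, d[, since exp(-1/(k t)) tends to 1 for t >
    0. *)
Definition expbump (k c d x : R) : R := expinv 0 (k * (x - c)) * expinv 0 (k * (d - x)).

Lemma smooth_expbump k c d : smooth (expbump k c d).
Proof.
move=> n; apply: CnM.
  rewrite (_ : (fun x => _) = fun x => expinv 0 (k * x + - (k * c))).
    by apply: Cn_affine; exact: smooth_expinv.
  by apply/funext => x; rewrite mulrBr.
rewrite (_ : (fun x => _) = fun x => expinv 0 (- k * x + k * d)).
  by apply: Cn_affine; exact: smooth_expinv.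
by apply/funext => x; rewrite mulrBr mulNr addrC.
Qed.

Lemma expbump_ge0 k c d x : 0 <= expbump k c d x.
Proof. by apply: mulr_ge0; exact: expinv0_ge0. Qed.

Lemma expbump_le1 k c d x : expbump k c d x <= 1.
Proof. by apply: mulr_ile1; rewrite ?expinv0_ge0 ?expinv0_le1. Qed.

Lemma expbump_neq0 k c d x : 0 < k -> (expbump k c d x != 0) = (c < x < d).
Proof.
move=> k0; rewrite mulf_eq0 negb_or.
have E (t : R) : (expinv 0 t != 0) = (0 < t).
  rewrite /expinv; case: ifPn => _; last by rewrite eqxx.
  by rewrite mulf_neq0// ?gt_eqF ?expR_gt0// expr0 invr1 ltr01.
by rewrite !E !pmulr_rgt0// !subr_gt0.
Qed.

Lemma cvg_expbump c d x : expbump n.+1%:R c d x @[n --> \oo] --> (\1_(`]c, d[) x : R).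
Proof.
have E (t : R) : expinv 0 (n.+1%:R * t) @[n --> \oo] --> ((0 < t)%R%:R : R).
  rewrite /expinv; have [t0|t0] := ltP 0 t.
    under eq_fun => n do rewrite pmulr_lgt0// ltr0n/= expr0 invr1 mul1r invfM mulrC.
    rewrite (_ : true%:R = expR (- (t^-1 * 0))); last by rewrite mulr0 oppr0 expR0.
    apply: continuous_cvg; first exact: continuous_expR.
    by apply: cvgN; apply: cvgMr; exact: cvg_harmonic.
  under eq_fun => n do rewrite ltNge mulr_ge0_le0//=.
  exact: cvg_cst.
rewrite indicE mem_setE in_itv/= -subr_gt0 -(subr_gt0 x d) -mulnb natrM.
exact: cvgM.
Qed.

End test_functions.

(** * The du Bois-Reymond lemma *)

Section du_bois_reymond.
Context {R : realType}.
Local Notation mu := (@lebesgue_measure R).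

Lemma ae_eq0_Rintegral_itv (H : R -> R) (a b : R) :
  mu.-integrable setT (EFin \o H) ->
  (forall c d, a < c -> c < d -> d < b -> \int[mu]_(x in `]c, d[) H x = 0) ->
  {ae mu, forall x, `]a, b[%classic x -> H x = 0}.
Proof.
move=> iH H0; pose z0 := (a + b) / 2.
have iHs (D : set R) : measurable D -> mu.-integrable D (EFin \o H).
  by move=> mD; exact: integrableS iH.
have eqI (c d : R) : a < c -> c < d -> d < b ->
    \int[mu]_(x in `]-oo, d]) H x = \int[mu]_(x in `]-oo, c]) H x.
  move=> ac cd db; apply/eqP; rewrite -subr_eq0 Rintegral_itvB//.
  - by rewrite -Rintegral_itv_bndo_bndc ?H0//; exact: iHs.
  - exact: iHs.
  - by rewrite bnd_simp ltW.
apply: (@ae_eq0_Rintegral _ H a b (\int[mu]_(x in `]-oo, z0]) H x)) => //.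
move=> z /andP[az zb]; have [zz0|zz0|->//] := ltgtP z z0.
- by apply/esym/eqI => //; rewrite /z0; lra.
- by apply/eqI => //; rewrite /z0; lra.
Qed.

Lemma cvg_Rintegral_expbump (G : R -> R) (c d : R) :
  mu.-integrable setT (EFin \o G) ->
  \int[mu]_x (G x * expbump n.+1%:R c d x) @[n --> \oo] --> \int[mu]_(x in `]c, d[) G x.
Proof.
move=> iG; have mG : measurable_fun setT G by case/integrableP : iG => /measurable_EFinP.
have iGcd : mu.-integrable setT (EFin \o (G \_ `]c, d[)).
  rewrite -[X in integrable _ _ X]restrict_EFin -integrable_mkcond//.
  exact: integrableS iG.
rewrite [X in _ --> X]Rintegral_mkcond; apply: fine_cvg.
rewrite fineK; last exact: integrable_fin_num iGcd.
have [| | | | |_ _] := @dominated_convergence _ _ R mu setT measurableT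
  (fun n x => (G x * expbump n.+1%:R c d x)%:E) (EFin \o (G \_ `]c, d[))
  (fun x => `|G x|%:E); last exact.
- move=> n; apply/measurable_EFinP; apply: measurable_funM => //.
  by apply: continuous_measurable_fun; exact/smooth_continuous/smooth_expbump.
- exact: (measurable_int _ iGcd).
- apply: aeW => x _; apply/cvg_EFin; first exact: nearW.
  have -> : (G \_ `]c, d[) x = G x * \1_(`]c, d[) x.
    by rewrite patchE indicE; case: ifP => _; rewrite ?mulr1 ?mulr0.
  by apply: cvgMr; exact: cvg_expbump.
- exact: (integrable_abse iG).
- apply: aeW => x n _; rewrite lee_fin normrM ler_piMr// ger0_norm ?expbump_ge0//.
  exact: expbump_le1.
Qed.

(** The hypothesis forces H to have the same mean over all intervals ]c, d[ with a < c < d < b.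
    Subtracting this mean leaves a function whose integral over each of them is 0, hence zero a.e.
    on ]a, b[. *)
Lemma du_bois_reymond (H : R -> R) (a b : R) : a < b ->
  mu.-integrable setT (EFin \o H) ->
  (forall phi, test_function `]a, b[ phi ->
     \int[mu]_x (H x * (phi^`()%classic) x) = 0) ->
  exists k, {ae mu, forall x, `]a, b[%classic x -> H x = k}.
Proof.
move=> ab iH Hphi.
have ibump k c d : 0 < k -> mu.-integrable setT (EFin \o expbump k c d).
  move=> k0; apply: (@integrable_smooth _ _ c d (smooth_expbump k c d)) => x.
  by rewrite expbump_neq0// => /andP[/ltW -> /ltW ->].
have iHbump k c d : mu.-integrable setT (fun x => (H x * expbump k c d x)%:E).
  have := @integrableMr _ _ _ mu setT measurableT (expbump k c d) (EFin \o H).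
  move=> /(_ _ _ iH); rewrite (_ : (_ \* _)%E = (fun x => (H x * expbump k c d x)%:E)).
    apply.
      by apply: continuous_measurable_fun; exact/smooth_continuous/smooth_expbump.
    exists 1; split => // M M1 x _ /=.
    by rewrite ger0_norm ?expbump_ge0// (le_trans (expbump_le1 _ _ _ _))// ltW.
  by apply/funext => x /=; rewrite -EFinM mulrC.
have i1 : mu.-integrable setT (EFin \o \1_(`]a, b[)).
  exact: integrable_indic_itv.
(* the combination of two bumps with integral zero is the derivative of a test
   function; letting k tend to infinity, the bumps become indicators *)
have key k c d c' d' : 0 < k -> a < c -> d < b -> a < c' -> d' < b ->
    (\int[mu]_x expbump k c' d' x) * (\int[mu]_x (H x * expbump k c d x)) =
    (\int[mu]_x expbump k c d x) * (\int[mu]_x (H x * expbump k c' d' x)).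
  move=> k0 ac db ac' db'.
  set I' := \int[mu]_x expbump k c' d' x; set I := \int[mu]_x expbump k c d x.
  pose f x := I' * expbump k c d x + - I * expbump k c' d' x.
  have sf : smooth f.
    by move=> n; apply: CnD; apply: CnM; by [exact: Cn_cst|exact: smooth_expbump].
  have fcd x : f x != 0 -> Num.min c c' <= x <= Num.max d d'.
    apply: contraNT => cdx; rewrite /f.
    have [->|] := eqVneq (expbump k c d x) 0; last first.
      rewrite expbump_neq0// => /andP[cx xd]; move: cdx.
      by rewrite ge_min le_max (ltW cx) (ltW xd).
    have [->|] := eqVneq (expbump k c' d' x) 0; last first.
      rewrite expbump_neq0// => /andP[cx xd]; move: cdx.
      by rewrite ge_min le_max (ltW cx) (ltW xd) !orbT.
    by rewrite !mulr0 addr0.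
  have f0 : \int[mu]_x f x = 0.
    have i1' : mu.-integrable setT (EFin \o (fun x => I' * expbump k c d x)).
      exact: (integrableZl measurableT I' (ibump _ c d k0)).
    have i2' : mu.-integrable setT (EFin \o (fun x => - I * expbump k c' d' x)).
      exact: (integrableZl measurableT (- I) (ibump _ c' d' k0)).
    rewrite (RintegralD measurableT i1' i2') (RintegralZl _ measurableT (ibump _ c d k0)).
    rewrite (RintegralZl _ measurableT (ibump _ c' d' k0)) -/I -/I' mulNr mulrC.
    exact: subrr.
  have [||phi tphi dphi] := primitive_test_function _ _ sf fcd f0 (a := a) (b := b).
  - by rewrite lt_min ac ac'.
  - by rewrite gt_max db db'.
  have := Hphi _ tphi; rewrite dphi.
  rewrite (_ : (fun x => _) = fun x =>
      I' * (H x * expbump k c d x) + - I * (H x * expbump k c' d' x)); last first.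
    by apply/funext => x; rewrite /f; ring.
  have j1 : mu.-integrable setT (EFin \o (fun x => I' * (H x * expbump k c d x))).
    exact: (integrableZl measurableT I' (iHbump k c d)).
  have j2 : mu.-integrable setT (EFin \o (fun x => - I * (H x * expbump k c' d' x))).
    exact: (integrableZl measurableT (- I) (iHbump k c' d')).
  rewrite (RintegralD measurableT j1 j2) (RintegralZl _ measurableT (iHbump k c d)).
  rewrite (RintegralZl _ measurableT (iHbump k c' d')) mulNr => /eqP.
  by rewrite subr_eq0 => /eqP.
have iD c d : a < c -> c < d -> d < b -> \int[mu]_(x in `]c, d[) \1_(`]a, b[) x = d - c.
  move=> ac cd db; rewrite (@eq_Rintegral _ _ _ mu _ (cst 1)); last first.
    move=> x /set_mem/=; rewrite in_itv/= => /andP[cx xd].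
    by rewrite indicE mem_set//= in_itv/= (lt_trans ac cx) (lt_trans xd db).
  by rewrite Rintegral_cst//= mul1r lebesgue_measure_itv/= lte_fin cd.
have keyl c d c' d' : a < c -> c < d -> d < b -> a < c' -> c' < d' -> d' < b ->
    (d' - c') * (\int[mu]_(x in `]c, d[) H x) = (d - c) * (\int[mu]_(x in `]c', d'[) H x).
  move=> ac cd db ac' cd' db'.
  rewrite -(iD _ _ ac cd db) -(iD _ _ ac' cd' db').
  (* The convergence statement takes an integrable weight, and the constant 1 is not integrable on
     the line; the indicator of ]a, b[ replaces it, since the bumps live inside. *)
  have cvg1 := @cvg_Rintegral_expbump (\1_(`]a, b[) : R -> R).
  have cvgH := @cvg_Rintegral_expbump H.
  have l1 := cvgM (cvg1 c' d' i1) (cvgH c d iH).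
  have l2 := cvgM (cvg1 c d i1) (cvgH c' d' iH).
  have bE n u v : a < u -> v < b ->
      \int[mu]_x (\1_(`]a, b[) x * expbump n.+1%:R u v x) =
      \int[mu]_x expbump n.+1%:R u v x.
    move=> au vb; apply: eq_Rintegral => x _; rewrite indicE mem_setE in_itv/=.
    have [->|] := eqVneq (expbump n.+1%:R u v x) 0; first by rewrite mulr0.
    rewrite expbump_neq0 ?ltr0n// => /andP[ux xv].
    by rewrite (lt_trans au ux) (lt_trans xv vb) mul1r.
  have l12 n : \int[mu]_x (\1_(`]a, b[) x * expbump n.+1%:R c' d' x) *
        \int[mu]_x (H x * expbump n.+1%:R c d x) =
      \int[mu]_x (\1_(`]a, b[) x * expbump n.+1%:R c d x) *
        \int[mu]_x (H x * expbump n.+1%:R c' d' x).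
    rewrite (bE _ _ _ ac' db') (bE _ _ _ ac db).
    exact: key (ltr0Sn R n) ac db ac' db'.
  have {}l1 := l1 _; have {}l2 := l2 _.
  apply: (@cvg_unique _ (@Rhausdorff R) _ _ _ _ (l1 _)) => //.
  apply: cvg_trans (l2 _); apply: near_eq_cvg; apply: nearW => n.
  exact/esym/l12.
(* The middle third serves as reference interval, with both ends strictly inside ]a, b[; the
   constant is the mean of H over it. *)
pose c0 := (2 * a + b) / 3; pose d0 := (a + 2 * b) / 3.
have ac0 : a < c0 by rewrite /c0; lra.
have cd0 : c0 < d0 by rewrite /c0 /d0; lra.
have db0 : d0 < b by rewrite /d0; lra.
pose K := (\int[mu]_(x in `]c0, d0[) H x) / (d0 - c0).
exists K.
pose F x := H x - K * \1_(`]a, b[) x.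
have iK : mu.-integrable setT (fun x => (K * \1_(`]a, b[) x)%:E).
  exact: (integrableZl measurableT K i1).
have iF : mu.-integrable setT (EFin \o F).
  exact: (integrableB measurableT iH iK).
have : {ae mu, forall x, `]a, b[%classic x -> F x = 0}.
  apply: ae_eq0_Rintegral_itv => // c d ac cd db.
  rewrite RintegralB//; try exact: integrableS iH; try exact: integrableS iK.
  rewrite RintegralZl//; last exact: integrableS i1.
  rewrite iD// /K.
  have := keyl _ _ _ _ ac cd db ac0 cd0 db0.
  move=> /(congr1 (fun x => (d0 - c0)^-1 * x)); rewrite mulKf; last by lra.
  by move=> ->; ring.
apply: filterS; first exact: (ae_filter_ringOfSetsType mu).
move=> x + abx => /(_ abx)/eqP; rewrite /F indicE mem_set// mulr1 subr_eq0.
by move/eqP.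
Qed.

End du_bois_reymond.

(** * Fractional derivatives of test functions *)

Section fracD_formula.
Context {R : realType}.
Local Notation mu := (@lebesgue_measure R).

Definition sgn_side (s : side) : R := if s is Left then 1 else -1.

Lemma norm_sgn_side s : `|sgn_side s| = 1.
Proof. by case: s; rewrite /= ?normrN normr1. Qed.

Lemma sgn_sideK s : sgn_side s * sgn_side s = 1.
Proof. by case: s; rewrite /= ?mulrNN mulr1. Qed.

Lemma fracIE s (a b sigma : R) (f : R -> R) (x : R) : a < x < b ->
  fracI s a b sigma f x =
  (Gamma sigma)^-1 * \int[mu]_y (pker sigma (sgn_side s * (x - y)) * (f \_ `]a, b[) y).
Proof.
move=> /andP[ax xb]; rewrite /fracI; congr (_ * _).
case: s; rewrite Rintegral_mkcond; congr Rintegral; apply/funext => y;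
  rewrite !patchE !mem_setE !in_itv/= /pker ?mul1r ?mulN1r ?opprB subr_gt0.
- case: (ltP y x) => yx; rewrite ?andbF ?andbT ?mul0r//.
  rewrite (lt_trans yx xb) andbT; case: ifPn => ay; last by rewrite mulr0.
  by rewrite -powRN opprB mulrC.
- case: (ltP x y) => xy; rewrite ?andbF ?andbT ?mul0r//.
  rewrite (lt_trans ax xy)/=; case: ifPn => ay; last by rewrite mulr0.
  by rewrite -powRN opprB mulrC.
Qed.

Lemma continuous_supp_bounded (g : R -> R) (a b : R) : a < b -> continuous g ->
  (forall x, ~ `]a, b[%classic x -> g x = 0) -> exists M : R, forall x, `|g x| <= M.
Proof.
move=> ab cg g0.
have [c _ gc] : exists2 c, c \in `[a, b]%R & forall t, t \in `[a, b]%R -> `|g t| <= `|g c|.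
  apply: EVT_max; first exact: ltW.
  apply: continuous_subspaceT => x.
  by apply: continuous_comp; [exact: cg|exact: norm_continuous].
exists `|g c| => x; have [xab|xab] := pselect (`]a, b[%classic x).
  by apply: gc; move: xab => /=; exact: subset_itv_oo_cc.
by rewrite g0// normr0.
Qed.

(** The variable is placed in phi and not in the singular kernel, so that the differentiated
    integrand is dominated by a multiple of |k|, and differentiation under the integral applies. *)
Lemma derive_conv (k phi : R -> R) (e x : R) :
  mu.-integrable setT (EFin \o k) -> (forall x, derivable phi x 1) ->
  continuous (phi^`()%classic : R -> R) ->
  (exists M : R, forall x, `|phi x| <= M) -> (exists M : R, forall x, `|phi^`()%classic x| <= M) ->
  derivable (fun x => \int[mu]_t (phi (x + e * t) * k t)) x 1 /\
  (fun x => \int[mu]_t (phi (x + e * t) * k t))^`()%classic x =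
  \int[mu]_t (phi^`()%classic (x + e * t) * k t).
Proof.
move=> ik dphi cphi' [M0 M0P] [M MP].
have cphi : continuous phi.
  by move=> y; apply/differentiable_continuous/derivable1_diffP.
have df (y t : R) : is_derive y 1 (fun z : R => phi (z + e * t) * k t)
    (phi^`()%classic (y + e * t) * k t).
  have h1 : is_derive (y + e * t) 1 phi (phi^`()%classic (y + e * t)).
    by apply: DeriveDef => //; rewrite derive1E.
  have h2 : is_derive y 1 (fun z : R => z + e * t) 1.
    by apply: is_derive_eq; rewrite addr0.
  have h3 := @is_derive1_comp _ phi (fun z => z + e * t) y _ _ h1 h2.
  have -> : (fun z => phi (z + e * t) * k t) = k t \*: (phi \o (fun z => z + e * t)).
    by apply/funext => z; rewrite /= mulrC.
  by apply: is_derive_eq; rewrite mulr1 /GRing.scale/= mulrC.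
have mshift (g : R -> R) (y : R) : continuous g -> measurable_fun setT (fun t => g (y + e * t)).
  move=> cg; apply: (@measurableT_comp _ _ _ _ _ _ g).
    exact: continuous_measurable_fun.
  by apply: measurable_funD => //; exact: measurable_funM.
have Ix : `](x - 1), (x + 1)[%classic x by rewrite /= in_itv/=; lra.
pose F (y t : R) := phi (y + e * t) * k t.
have intF (y : R) : `](x - 1), (x + 1)[%classic y -> mu.-integrable setT (EFin \o F y).
  move=> _; have := @integrableMr _ _ _ mu setT measurableT (fun t => phi (y + e * t)) (EFin \o k).
  apply => //; first exact: mshift.
  exists M0; split; first exact: num_real.
  move=> N N0 t _ /=; exact: (le_trans (M0P _) (ltW N0)).
have derF (y t : R) : `](x - 1), (x + 1)[%classic y -> setT t -> derivable (F ^~ t) y 1.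
  by move=> _ _; case: (df y t).
have G0 (t : R) : 0 <= `|M| * `|k t| by rewrite mulr_ge0.
have intG : mu.-integrable setT (EFin \o (fun t => `|M| * `|k t|)).
  exact: (integrableZl measurableT `|M| (integrable_abse ik)).
have Gub (y t : R) : `](x - 1), (x + 1)[%classic y -> setT t ->
    `|partial1of2 F y t| <= `|M| * `|k t|.
  move=> _ _; rewrite partial1of2E; have [_ ->] := df y t.
  by rewrite normrM ler_wpM2r// (le_trans (MP _))// ler_norm.
split.
  exact: (@derivable_under_integral R _ _ mu F setT measurableT x (x - 1)
    (x + 1) Ix intF derF _ G0 intG Gub).
rewrite (@differentiation_under_integral R _ _ mu F setT measurableT x (x - 1)
  (x + 1) Ix intF derF _ G0 intG Gub).
by apply: eq_Rintegral => t _; rewrite partial1of2E; case: (df x t).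
Qed.

Lemma test_function_out (D : set R) (phi : R -> R) : test_function D phi ->
  forall x, ~ D x -> phi x = 0 /\ phi^`()%classic x = 0.
Proof.
move=> [_ _ sD] x Dx.
have cx : ~ closure [set x | phi x != 0] x by move=> /sD.
have nx : \near x, phi x = cst 0 x.
  have : nbhs x (~` closure [set x | phi x != 0]).
    by apply: open_nbhs_nbhs; split=> //; apply: closed_openC; exact: closed_closure.
  apply: filterS => y cy; apply/eqP; apply: contra_notT cy => py.
  exact: subset_closure.
split; first exact: (nbhs_singleton nx).
by rewrite derive1E (near_eq_derive _ nx) derive_cst.
Qed.

Lemma test_function_derivable (D : set R) (phi : R -> R) : test_function D phi ->
  [/\ forall x, derivable phi x 1, continuous phi & continuous (phi^`()%classic : R -> R)].
Proof.
move=> [dphi _ _]; split => x; first exact: (dphi 0%N).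
  by apply/differentiable_continuous/derivable1_diffP; exact: (dphi 0%N).
by apply/differentiable_continuous/derivable1_diffP; exact: (dphi 1%N).
Qed.

(* For x and y in ]a, b[ the kernel is only evaluated below b - a: the
   truncation is integrable and defines the same convolution. *)
Definition tker (sigma L t : R) := if t < L then pker sigma t else 0.

Lemma integrable_tker (sigma L : R) : 0 < sigma -> mu.-integrable setT (EFin \o tker sigma L).
Proof.
move=> s0.
have -> : EFin \o tker sigma L = (EFin \o pker sigma) \_ `]-oo, L[.
  by apply/funext => t; rewrite patchE mem_setE in_itv/= /tker; case: ifP.
rewrite -integrable_mkcond//; apply/integrableP; split.
  by apply/measurable_EFinP/measurable_funTS; exact: measurable_pker.
under eq_integral do rewrite /= ger0_norm ?pker_ge0//.
exact: integral_pker_lty.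
Qed.

(** Substitute y = x - e t. For t >= b - a the point y leaves ]a, b[, where g vanishes, so the
    truncation changes nothing. *)
Lemma conv_tker (sigma a b e : R) (g : R -> R) (x : R) : `|e| = 1 ->
  measurable_fun setT g -> (forall y, ~ `]a, b[%classic y -> g y = 0) -> a < x < b ->
  \int[mu]_y (pker sigma (e * (x - y)) * g y) =
  \int[mu]_t (g (x + - e * t) * tker sigma (b - a) t).
Proof.
move=> e1 mg g0 /andP[ax xb]; have ee : e * e = 1.
  by rewrite -expr2 -real_normK ?num_real// e1 expr1n.
have Ne1 : `|- e| = 1 by rewrite normrN.
rewrite /Rintegral (integral_affine1 x Ne1); last first.
  apply/measurable_EFinP; apply: measurable_funM => //.
  apply: measurableT_comp; first exact: measurable_pker.
  by apply: measurable_funM => //; exact: measurable_funB.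
congr fine; apply: eq_integral => t _; congr (_%:E).
have -> : e * (x - (- e * t + x)) = t.
  by transitivity (e * e * t); [ring|rewrite ee mul1r].
rewrite mulrC (addrC x) /tker; case: ifPn => // tL.
have [t0|t0] := ltP 0 t; last by rewrite /pker ltNge t0.
rewrite g0 ?mul0r//= in_itv/=; move: tL; rewrite -leNgt => tL.
move/eqP: e1; rewrite eqr_norml => /andP[/orP[/eqP eE|/eqP eE] _]; rewrite eE; lra.
Qed.

(** The derivative passes onto phi without boundary terms, as phi vanishes outside ]a, b[. The
    result is the opposite-side fractional integral of phi', written with the transpose of the
    kernel of side s, ready for Fubini. *)
Lemma fracD_test s (a b al : R) (phi : R -> R) (x : R) : a < b -> 0 < al < 1 ->
  test_function `]a, b[ phi -> a < x < b ->
  fracD (opp_side s) a b al phi x = - sgn_side s *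
    ((Gamma (1 - al))^-1 *
     \int[mu]_y (pker (1 - al) (sgn_side s * (y - x)) * phi^`()%classic y)).
Proof.
move=> ab al01 tphi xab.
have sg r : fracD r a b al phi x = sgn_side r * (fracI r a b (1 - al) phi)^`()%classic x.
  by case: r; rewrite /fracD/= ?mul1r ?mulN1r.
have sgo : sgn_side (opp_side s) = - sgn_side s by case: s => /=; rewrite ?opprK.
rewrite sg sgo; congr (_ * _).
set r := opp_side s in sgo *.
have out := test_function_out tphi.
have [dphi cphi cphi'] := test_function_derivable tphi.
have mphi : measurable_fun setT phi by exact: continuous_measurable_fun.
have mphi' : measurable_fun setT (phi^`()%classic : R -> R) by exact: continuous_measurable_fun.
have out0 y : ~ `]a, b[%classic y -> phi y = 0 by move=> /out[].
have out1 y : ~ `]a, b[%classic y -> phi^`()%classic y = 0 by move=> /out[].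
pose G x := \int[mu]_t (phi (x + - sgn_side r * t) * tker (1 - al) (b - a) t).
have fG (z : R) : a < z < b -> fracI r a b (1 - al) phi z = (Gamma (1 - al))^-1 * G z.
  move=> zab; rewrite fracIE//; congr (_ * _).
  rewrite /G -(conv_tker (1 - al) (norm_sgn_side r) mphi out0 zab).
  apply: eq_Rintegral => y _; congr (_ * _); rewrite patchE; case: ifPn => // /negP yab.
  by apply/esym/out0 => /mem_set.
have al1 : 0 < 1 - al by lra.
have [dG GE] : derivable G x 1 /\ G^`()%classic x =
    \int[mu]_t (phi^`()%classic (x + - sgn_side r * t) * tker (1 - al) (b - a) t).
  apply: derive_conv => //.
  - exact: integrable_tker.
  - exact: (continuous_supp_bounded ab cphi out0).
  - exact: (continuous_supp_bounded ab cphi' out1).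
transitivity ((Gamma (1 - al))^-1 * G^`()%classic x).
  rewrite !derive1E -[RHS]/((Gamma (1 - al))^-1 *: 'D_1 G x) -deriveZ//.
  apply: near_eq_derive; near=> z; apply: fG; apply/andP; split.
    by near: z; apply: lt_nbhsr; case/andP : xab.
  by near: z; apply: lt_nbhsl; case/andP : xab.
apply: (congr1 (fun t => (Gamma (1 - al))^-1 * t)); apply: etrans GE _.
apply: etrans (esym (conv_tker (1 - al) (norm_sgn_side r) mphi' out1 xab)) _.
by rewrite sgo; apply: eq_Rintegral => y _; rewrite mulNr -mulrN opprB.
Unshelve. all: by end_near. Qed.

End fracD_formula.

(** * Absolutely continuous representatives and their endpoint values *)

Section absolute_continuity.
Context {R : realType}.
Local Notation mu := (@lebesgue_measure R).

(** The integral of |V| over a set of small measure is small; apply this to the union of the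
    disjoint intervals, whose measure is at most the sum of their lengths. *)
Lemma abs_continuous_integral (V g : R -> R) (a b : R) :
  mu.-integrable setT (EFin \o V) ->
  (forall x y, a <= x -> x <= y -> y <= b ->
     (`|g y - g x|%:E <= \int[mu]_(t in `]x, y[) `|V t|%:E)%E) ->
  abs_continuous a b g.
Proof.
move=> iV gV e e0; have [d [d0 dP]] := integral_normr_continuous iV e0.
exists d => // n x y xy tI sd.
pose A := \big[setU/set0]_(i < n) `]x i, y i[%classic.
have mA : measurable A by apply: bigsetU_measurable => i _; exact: measurable_itv.
have tI' : trivIset [set: 'I_n] (fun i => `]x i, y i[%classic : set R) by exact: tI.
have muA : (mu A < d%:E)%E.
  rewrite /A measure_semi_additive_ord//=.
  apply: le_lt_trans (_ : _ <= (\sum_(i < n) (y i - x i))%:E)%E _; last by rewrite lte_fin.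
  rewrite -sumEFin; apply: lee_sum => i _; have [_ [xyi _]] := xy i.
  rewrite lebesgue_measure_itv/= lte_fin; case: ifPn => // _.
  by rewrite lee_fin subr_ge0.
have mV : measurable_fun setT V by case/integrableP : iV => /measurable_EFinP.
have iA : mu.-integrable A (EFin \o (fun t => `|V t|)).
  by apply: integrableS (integrable_abse iV).
apply: le_lt_trans (dP A mA muA).
rewrite -lee_fin /Rintegral fineK; last exact: integrable_fin_num iA.
rewrite -sumEFin /A ge0_integral_bigsetU//=.
- by apply: lee_sum => i _; have [axi [xyi yib]] := xy i; exact: gV.
- by rewrite index_enum_uniq.
- by apply: sub_trivIset tI'.
- apply/measurable_EFinP; apply: measurable_funTS; exact: measurableT_comp.
Qed.

Lemma abs_continuousN1 (a b : R) (g : R -> R) (e : R) : abs_continuous a b g -> 0 < e ->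
  exists2 d : R, 0 < d & forall x y, a <= x -> x <= y -> y <= b -> y - x < d -> `|g y - g x| < e.
Proof.
move=> ac e0; have [d d0 dP] := ac e e0; exists d => // x y ax xy yb yxd.
have := dP 1%N (fun=> x) (fun=> y); rewrite !big_ord1; apply=> //.
by move=> i j _ _ _; rewrite !ord1.
Qed.

Lemma ae_itv_ex (P : R -> Prop) (a b c d : R) : c < d -> a <= c -> d <= b ->
  {ae mu, forall x, `]a, b[%classic x -> P x} -> exists2 x, c < x < d & P x.
Proof.
move=> cd ac db [N [mN N0 PN]]; apply: contrapT => nP.
have : `]c, d[%classic `<=` N.
  move=> x /=; rewrite in_itv/= => /andP[cx xd]; apply: PN => /= h; apply: nP.
  exists x; first by rewrite cx.
  by apply: h; rewrite in_itv/= (le_lt_trans ac cx) (lt_le_trans xd db).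
move=> /(le_measure mu); rewrite !inE => /(_ (measurable_itv _) mN).
move=> cdN; have : (mu (`]c, d[%classic : set R) <= 0)%E by rewrite -N0; exact: cdN.
by rewrite lebesgue_measure_itv/= lte_fin cd -EFinB lee_fin subr_le0 leNgt cd.
Qed.

(** Two absolutely continuous representatives agree a.e. on ]a, b[, hence at points arbitrarily
    close to the endpoint, and by continuity at the endpoint. The value chosen by [xget] is
    therefore that of any known representative. *)
Lemma ac_value_eq (a b x0 : R) (f g : R -> R) : a < b -> x0 = a \/ x0 = b ->
  abs_continuous a b g ->
  {ae mu, forall x, `]a, b[%classic x -> g x = f x} -> ac_value a b f x0 = g x0.
Proof.
move=> ab x0ab acg gf; rewrite /ac_value; apply: xget_unique; first by exists g.
move=> _ [h [ach hf ->]].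
have gh : {ae mu, forall x, `]a, b[%classic x -> g x = h x}.
  move: gf hf; apply: filterS2; first exact: (ae_filter_ringOfSetsType mu).
  by move=> x gfx hfx abx; rewrite gfx// hfx.
apply/eqP; rewrite -subr_eq0 -normr_eq0; apply/eqP/le_anti; rewrite normr_ge0 andbT.
apply/ler_addgt0Pr => e e0; rewrite add0r.
have e20 : 0 < e / 2 by rewrite divr_gt0.
have [d1 d10 d1P] := abs_continuousN1 acg e20.
have [d2 d20 d2P] := abs_continuousN1 ach e20.
pose d := Num.min (Num.min d1 d2) (b - a).
have d0 : 0 < d by rewrite !lt_min d10 d20 subr_gt0.
have dd1 : d <= d1 by rewrite !ge_min lexx.
have dd2 : d <= d2 by rewrite !ge_min lexx orbT.
have dba : d <= b - a by rewrite !ge_min lexx orbT.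
have tri (x : R) : g x = h x -> `|g x - g x0| < e / 2 -> `|h x - h x0| < e / 2 ->
    `|h x0 - g x0| <= e.
  move=> ghx h1 h2; have -> : h x0 - g x0 = (g x - g x0) - (h x - h x0).
    by rewrite ghx; ring.
  apply: le_trans (ler_normB _ _) _; lra.
case: x0ab => x0E; subst x0.
- have [|||x /andP[cx xd] ghx] := ae_itv_ex (c := a) (d := a + d) _ _ _ gh; [lra|lra|lra|].
  apply: (tri _ ghx); [apply: d1P|apply: d2P]; lra.
- have [|||x /andP[cx xd] ghx] := ae_itv_ex (c := b - d) (d := b) _ _ _ gh; [lra|lra|lra|].
  apply: (tri _ ghx); rewrite distrC; [apply: d1P|apply: d2P]; lra.
Qed.

End absolute_continuity.

(** * Young's inequality for a nonnegative integrable kernel *)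

Section young.
Context {R : realType}.
Local Notation mu := (@lebesgue_measure R).
Local Open Scope ereal_scope.

Lemma le_poweR (x y : \bar R) (r : R) : (0 <= r)%R -> 0 <= x -> x <= y ->
  x `^ r <= y `^ r.
Proof.
move=> r0 x0 xy; apply: gt0_ler_poweR => //; rewrite in_itv/= leey andbT//.
exact: le_trans xy.
Qed.

(** Hoelder's inequality for h^(1/p) |V| and h^(1/q), where q = p/(p-1) and p/q = p - 1. The case p
    = 1 is separate because q would be infinite. *)
Lemma jensen_kernel (h V : R -> R) (K p : R) : (1 <= p)%R ->
  measurable_fun setT h -> measurable_fun setT V -> (forall y, 0 <= h y)%R ->
  \int[mu]_y (h y)%:E = K%:E ->
  (\int[mu]_y (h y * `|V y|)%:E) `^ p <=
  (K `^ (p - 1))%:E * \int[mu]_y (h y * `|V y| `^ p)%:E.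
Proof.
move=> p1 mh mV h0 hK.
have K0 : (0 <= K)%R by rewrite -lee_fin -hK; apply: integral_ge0 => y _; rewrite lee_fin.
have [->|pn1] := eqVneq p 1%R.
  rewrite subrr powRr0 mul1e poweRe1; last first.
    by apply: integral_ge0 => y _; rewrite lee_fin mulr_ge0.
  by under [leRHS]eq_integral do rewrite powRr1//.
have {pn1}p1 : (1 < p)%R by rewrite lt_neqAle eq_sym pn1.
have p0 : (0 < p)%R by apply: lt_trans p1.
pose q : R := (p / (p - 1))%R.
have q0 : (0 < q)%R by rewrite divr_gt0// subr_gt0.
have pq : (p^-1 + q^-1 = 1)%R.
  by rewrite /q invf_div -[X in (X + _)%R]mul1r -mulrDl addrC subrK divff// gt_eqF.
pose f y : R := (h y `^ p^-1 * `|V y|)%R.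
pose g y : R := (h y `^ q^-1)%R.
have mf : measurable_fun setT f.
  apply: measurable_funM; last exact: measurableT_comp.
  exact: (measurableT_comp (measurable_powR _)).
have mg : measurable_fun setT g by exact: (measurableT_comp (measurable_powR _)).
have hol := hoelder mu mf mg p0 q0 pq.
have fg : 'N[mu]_1[EFin \o (f \* g)%R] = \int[mu]_y (h y * `|V y|)%:E.
  rewrite Lnorm1; apply: eq_integral => y _ /=; congr (_%:E).
  rewrite /f /g ger0_norm ?mulr_ge0 ?powR_ge0// mulrAC -powRD; last first.
    by rewrite pq oner_eq0.
  by rewrite pq powRr1.
have Nf : 'N[mu]_p%:E[EFin \o f] `^ p = \int[mu]_y (h y * `|V y| `^ p)%:E.
  rewrite poweR_Lnorm ?gt_eqF//; apply: eq_integral => y _ /=.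
  rewrite /f ger0_norm ?mulr_ge0 ?powR_ge0// powRM ?powR_ge0// -powRrM mulVf ?gt_eqF//.
  by rewrite powRr1.
have Ng : 'N[mu]_q%:E[EFin \o g] = (K `^ q^-1)%:E.
  rewrite unlock -poweR_EFin -hK; congr (_ `^ _); apply: eq_integral => y _ /=.
  rewrite /g ger0_norm ?powR_ge0// -powRrM mulVf ?gt_eqF// powRr1//.
rewrite -fg -Nf; apply: le_trans
  (_ : _ <= ('N[mu]_p%:E[EFin \o f] * 'N[mu]_q%:E[EFin \o g]) `^ p) _.
  by apply: le_poweR => //; [exact: ltW|exact: Lnorm_ge0].
rewrite Ng poweRM ?Lnorm_ge0 ?lee_fin ?powR_ge0// muleC.
rewrite poweR_EFin -powRrM (_ : q^-1 * p = p - 1)%R//.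
by rewrite /q invf_div divfK// gt_eqF.
Qed.

(** Raise the pointwise bound to the power p and apply the Jensen-type estimate at each x. Tonelli
    then integrates the kernel in x, which contributes a further K, and K^(p-1) K = K^p. *)
Lemma Lnorm_young (k V w : R -> R) (e K p : R) : (1 <= p)%R -> `|e|%R = 1%R ->
  measurable_fun setT k -> measurable_fun setT V -> measurable_fun setT w ->
  (forall y, 0 <= k y)%R -> \int[mu]_y (k y)%:E = K%:E ->
  (forall x, `|w x|%:E <= \int[mu]_y (k (e * (x - y)) * `|V y|)%:E) ->
  'N[mu]_p%:E[EFin \o w] <= K%:E * 'N[mu]_p%:E[EFin \o V].
Proof.
move=> p1 e1 mk mV mw k0 kK wk.
have K0 : (0 <= K)%R by rewrite -lee_fin -kK; apply: integral_ge0 => y _; rewrite lee_fin.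
have p0 : (0 < p)%R by apply: lt_le_trans p1.
have ee : (e * e = 1)%R by rewrite -expr2 -real_normK ?num_real// e1 expr1n.
have mkx x : measurable_fun setT (fun y : R => k (e * (x - y))%R).
  by apply: measurableT_comp => //; apply: measurable_funM => //; exact: measurable_funB.
have mky y : measurable_fun setT (fun x : R => k (e * (x - y))%R).
  by apply: measurableT_comp => //; apply: measurable_funM => //; exact: measurable_funB.
have kx x : \int[mu]_y (k (e * (x - y)))%:E = K%:E.
  have Ne1 : `|- e|%R = 1%R by rewrite normrN.
  rewrite (integral_affine1 x Ne1); last exact/measurable_EFinP.
  rewrite -kK; apply: eq_integral => t _; congr (k _)%:E.
  by transitivity (e * e * t)%R; [ring|rewrite ee mul1r].
have ky y : \int[mu]_x (k (e * (x - y)))%:E = K%:E.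
  rewrite (integral_affine1 y e1); last exact/measurable_EFinP.
  rewrite -kK; apply: eq_integral => t _; congr (k _)%:E.
  by rewrite addrK mulrA ee mul1r.
pose F (z : R * R) := (k (e * (z.1 - z.2)) * `|V z.2| `^ p)%:E.
have F0 z : 0 <= F z by rewrite lee_fin mulr_ge0 ?powR_ge0.
have mVp : measurable_fun setT (fun y : R => (`|V y| `^ p)%R).
  by apply: (measurableT_comp (measurable_powR _)); exact: measurableT_comp.
have mF : measurable_fun [set: measurableTypeR R * measurableTypeR R] F.
  apply/measurable_EFinP; apply: measurable_funM.
    apply: measurableT_comp => //; apply: measurable_funM => //.
    exact: measurable_funB.
  exact: (measurableT_comp mVp measurable_snd).
have mF1 : measurable_fun setT (fun x : measurableTypeR R => \int[mu]_y F (x, y)).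
  exact: (@measurable_fun_fubini_tonelli_F _ _ (measurableTypeR R)
    (measurableTypeR R) R mu F mF F0).
have inner y : \int[mu]_x F (x, y) = K%:E * (`|V y| `^ p)%:E.
  rewrite -(ky y) -ge0_integralZr//.
  - by apply/measurable_EFinP; exact: mky.
  - by move=> x _; rewrite lee_fin.
have main : \int[mu]_x (`|w x| `^ p)%:E <= (K `^ p)%:E * \int[mu]_x (`|V x| `^ p)%:E.
  apply: (@le_trans _ _ (\int[mu]_x ((K `^ (p - 1))%:E * \int[mu]_y F (x, y)))).
    apply: ge0_le_integral => //.
    - apply/measurable_EFinP; apply: (measurableT_comp (measurable_powR _)).
      exact: measurableT_comp.
    - by apply: measurable_funeM.
    - move=> x _; rewrite -poweR_EFin.
      apply: le_trans (jensen_kernel p1 (mkx x) mV (fun y => k0 _) (kx x)).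
      by apply: le_poweR => //; exact: ltW.
  rewrite ge0_integralZl//; last 2 first.
  - by move=> x _; exact: integral_ge0.
  - by rewrite lee_fin powR_ge0.
  rewrite (@fubini_tonelli _ _ _ _ R mu mu F mF F0).
  rewrite [X in _ * X <= _](_ : _ = \int[mu]_y (K%:E * (`|V y| `^ p)%:E)); last first.
    by apply: eq_integral => y _; exact: inner.
  rewrite ge0_integralZl//; last exact/measurable_EFinP.
  rewrite muleA -EFinM lee_wpmul2r//; first exact: integral_ge0.
  rewrite lee_fin; have [->|Kn0] := eqVneq K 0%R; first by rewrite mulr0 powR_ge0.
  by rewrite -{2}(powRr1 K0) -powRD ?Kn0 ?implybT// subrK.
rewrite unlock -[X in X%:E * _](powRr1 K0) -(mulfV (lt0r_neq0 p0)) powRrM -poweR_EFin.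
rewrite -poweRM.
- apply: le_poweR; first by rewrite invr_ge0 ltW.
    by apply: integral_ge0 => x _; exact: poweR_ge0.
  exact: main.
- by rewrite lee_fin powR_ge0.
- by apply: integral_ge0 => x _; exact: poweR_ge0.
Qed.

End young.

(** * Composition of fractional integrals and the representation of u *)

Section fractional_representation.
Context {R : realType}.
Local Notation mu := (@lebesgue_measure R).
Variables (s : side) (a b : R).
Hypothesis ab : a < b.

Let e : R := sgn_side s.
Let D : set R := `]a, b[%classic.
Let x0 : R := match s with Left => a | Right => b end.

Let e1 : `|e| = 1. Proof. exact: norm_sgn_side. Qed.
Let Ne1 : `|- e| = 1. Proof. by rewrite normrN. Qed.
Let ecase : e = 1 /\ x0 = a \/ e = -1 /\ x0 = b.
Proof. by rewrite /e /x0; case: s; [left|right]. Qed.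

(** For f vanishing outside ]a, b[ and x inside, this is Gamma(sigma) times the fractional integral
    of side [s]; leaving the Gamma factor out keeps the kernel computations free of constants. *)
Definition fconv (sigma : R) (f : R -> R) (x : R) : R :=
  \int[mu]_y (pker sigma (e * (x - y)) * f y).

Let mpkerxy (sigma : R) :
  measurable_fun setT (fun z : R * R => pker sigma (e * (z.1 - z.2))).
Proof.
apply: measurableT_comp; first exact: measurable_pker.
by apply: measurable_funM => //; exact: measurable_funB.
Qed.

Let mpkerx (sigma c y : R) : measurable_fun setT (fun x : R => pker sigma (c * (x - y))).
Proof.
apply: measurableT_comp; first exact: measurable_pker.
by apply: measurable_funM => //; exact: measurable_funB.
Qed.

Let mpkery (sigma c x : R) : measurable_fun setT (fun y : R => pker sigma (c * (x - y))).
Proof.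
apply: measurableT_comp; first exact: measurable_pker.
by apply: measurable_funM => //; exact: measurable_funB.
Qed.

Let mD : measurable_fun setT (\1_D : R -> R).
Proof. by apply: measurable_indic; exact: measurable_itv. Qed.

Let mpkerxD (sigma c y : R) :
  measurable_fun setT (fun x : R => pker sigma (c * (x - y)) * \1_D x).
Proof. by apply: measurable_funM; [exact: mpkerx|exact: mD]. Qed.

Let mpkeryD (sigma c x : R) :
  measurable_fun setT (fun y : R => pker sigma (c * (x - y)) * \1_D y).
Proof. by apply: measurable_funM; [exact: mpkery|exact: mD]. Qed.

Let supported (f : R -> R) := forall x, ~ D x -> f x = 0.

Let supp_in f x : supported f -> f x != 0 -> D x.
Proof. by move=> sf; apply: contra_neqP => /sf. Qed.

(** The constant is a bound of |g| times the mass T of the kernel below b - a, uniformly over y in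
    ]a, b[. *)
Lemma pker_kernel_bound (sigma : R) (f g : R -> R) : 0 < sigma ->
  supported f -> supported g -> measurable_fun setT g ->
  (exists M : R, forall x, `|g x| <= M) ->
  exists M : R, forall y, f y != 0 ->
    (\int[mu]_x (`|pker sigma (e * (x - y))| * `|g x|)%:E <= M%:E)%E.
Proof.
move=> s0 sf sg mg [M gM].
have M0 : 0 <= M by apply: le_trans (gM 0).
pose T := fine (\int[mu]_(t in `]-oo, (b - a)%R[) (pker sigma t)%:E)%E.
have TE : (\int[mu]_(t in `]-oo, (b - a)%R[) (pker sigma t)%:E = T%:E)%E.
  rewrite /T fineK// ge0_fin_numE; first exact: integral_pker_lty.
  by apply: integral_ge0 => t _; rewrite lee_fin pker_ge0.
exists (M * T) => y /(supp_in sf); rewrite /D/= in_itv/= => /andP[ay yb].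
rewrite EFinM -TE.
apply: le_trans (_ : _ <= M%:E * \int[mu]_x (pker sigma (e * (x - y)) * \1_D x)%:E)%E _; last first.
  apply: lee_wpmul2l; first by rewrite lee_fin.
  by apply: integral_pker_le => //; rewrite (ltW ay) (ltW yb).
rewrite -ge0_integralZl//; last 2 first.
- by apply/measurable_EFinP; exact: mpkerxD.
- by move=> x _; rewrite lee_fin mulr_ge0 ?pker_ge0.
apply: ge0_le_integral => //.
- apply/measurable_EFinP; apply: measurable_funM; apply: measurableT_comp => //.
  exact: mpkerx.
- by apply: measurable_funeM; apply/measurable_EFinP; exact: mpkerxD.
move=> x _; rewrite -EFinM lee_fin ger0_norm ?pker_ge0// mulrCA ler_wpM2l ?pker_ge0//.
rewrite indicE; have [Dx|Dx] := boolP (x \in D); first by rewrite mulr1.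
by rewrite sg ?normr0 ?mulr0// => /mem_set; exact/negP.
Qed.

(** Fractional integration by parts, with f only integrable and g bounded. *)
Lemma fconv_adjoint (sigma : R) (f g : R -> R) : 0 < sigma ->
  mu.-integrable setT (EFin \o f) -> supported f ->
  measurable_fun setT g -> supported g -> (exists M : R, forall x, `|g x| <= M) ->
  \int[mu]_x (g x * fconv sigma f x) =
  \int[mu]_y (f y * \int[mu]_x (pker sigma (e * (x - y)) * g x)).
Proof.
move=> s0 intf sf mg sg bg; have [M KM] := pker_kernel_bound s0 sf sg mg bg.
exact: (kernel_fubini (mpkerxy sigma) mg intf KM).
Qed.

Lemma integrable_fconv_bounded (sigma : R) (f g : R -> R) : 0 < sigma ->
  mu.-integrable setT (EFin \o f) -> supported f ->
  measurable_fun setT g -> supported g -> (exists M : R, forall x, `|g x| <= M) ->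
  mu.-integrable setT (fun x => (g x * fconv sigma f x)%:E).
Proof.
move=> s0 intf sf mg sg bg; have [M KM] := pker_kernel_bound s0 sf sg mg bg.
exact: (integrable_kernel_l (mpkerxy sigma) mg intf KM).
Qed.

Lemma integrable_fconv_adjoint (sigma : R) (f g : R -> R) : 0 < sigma ->
  mu.-integrable setT (EFin \o f) -> supported f ->
  measurable_fun setT g -> supported g -> (exists M : R, forall x, `|g x| <= M) ->
  mu.-integrable setT (fun y => (f y * \int[mu]_x (pker sigma (e * (x - y)) * g x))%:E).
Proof.
move=> s0 intf sf mg sg bg; have [M KM] := pker_kernel_bound s0 sf sg mg bg.
exact: (integrable_kernel_r (mpkerxy sigma) mg intf KM).
Qed.

Lemma measurable_fconv (sigma : R) (f : R -> R) :
  mu.-integrable setT (EFin \o f) -> measurable_fun setT (fconv sigma f).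
Proof.
by move=> intf; exact: (measurable_kernel_l (mpkerxy sigma) intf).
Qed.

(** The fundamental theorem of calculus from the end where the transposed kernel lives. In this form
    phi has the same shape as its fractional derivative, with order 1 in place of 1 - al. *)
Lemma test_function_repr (phi : R -> R) (x : R) : test_function D phi -> D x ->
  phi x = - e * \int[mu]_y (pker 1 (e * (y - x)) * phi^`()%classic y).
Proof.
move=> tphi; rewrite /D/= in_itv/= => /andP[ax xb].
have [dphi cphi cphi'] := test_function_derivable tphi.
have out := test_function_out tphi.
have FTC c d : c < d -> \int[mu]_(y in `]c, d[) phi^`()%classic y = phi d - phi c.
  move=> cd; rewrite /Rintegral -(@integral_itv_bndoo _ _ _ _ true false); last first.
    apply/measurable_EFinP; apply: measurable_funTS.
    exact: continuous_measurable_fun.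
  have cw : {within `[c, d], continuous (phi^`()%classic : R -> R)}.
    exact: continuous_subspaceT.
  have dLR : derivable_oo_LRcontinuous phi c d.
    split; first by move=> y _; exact: dphi.
    + exact/cvg_at_right_filter/cphi.
    + exact/cvg_at_left_filter/cphi.
  by rewrite (continuous_FTC2 cd cw dLR (fun _ _ => erefl)).
have out_ y : ~ D y -> phi^`()%classic y = 0 by move=> /out[].
have [[-> _]|[-> _]] := ecase.
- have -> : \int[mu]_y (pker 1 (1 * (y - x)) * phi^`()%classic y) =
      \int[mu]_(y in `]x, b[) phi^`()%classic y.
    rewrite [RHS]Rintegral_mkcond; apply: eq_Rintegral => y _.
    rewrite patchE mem_setE in_itv/= mul1r pker1 subr_gt0.
    case: (ltP x y) => xy; rewrite ?mul0r ?mul1r//=; case: ifPn => // yb.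
    by rewrite out_// /D/= in_itv/= (negbTE yb) andbF.
  by rewrite FTC// (out b _).1 ?sub0r ?mulN1r ?opprK// /D/= in_itv/= ltxx andbF.
- have -> : \int[mu]_y (pker 1 (-1 * (y - x)) * phi^`()%classic y) =
      \int[mu]_(y in `]a, x[) phi^`()%classic y.
    rewrite [RHS]Rintegral_mkcond; apply: eq_Rintegral => y _.
    rewrite patchE mem_setE in_itv/= mulN1r opprB pker1 subr_gt0.
    case: (ltP y x) => xy; rewrite ?andbF ?mul0r ?mul1r//= andbT; case: ifPn => // ya.
    by rewrite out_// /D/= in_itv/= (negbTE ya).
  by rewrite FTC// (out a _).1 ?subr0 ?opprK ?mul1r// /D/= in_itv/= ltxx.
Qed.

(** Both phi and its fractional derivative are -e times a transposed kernel applied to phi'. Moving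
    the kernels onto v and u and cancelling -e leaves an equation tested against phi' alone. *)
Lemma weak_fconv (al : R) (u v : R -> R) : 0 < al < 1 ->
  mu.-integrable setT (EFin \o (u \_ D)) -> mu.-integrable setT (EFin \o (v \_ D)) ->
  is_weak_fracD s a b al u v ->
  forall phi, test_function D phi ->
    \int[mu]_x (phi^`()%classic x * ((Gamma (1 - al))^-1 * fconv (1 - al) (u \_ D) x)) =
    \int[mu]_x (phi^`()%classic x * fconv 1 (v \_ D) x).
Proof.
move=> al01 iU iV [_ _ wk] phi tphi.
have al1 : 0 < 1 - al by lra.
have [dphi cphi cphi'] := test_function_derivable tphi.
have out := test_function_out tphi.
have sphi' : supported (phi^`()%classic) by move=> y /out[].
have mphi' : measurable_fun setT (phi^`()%classic : R -> R) by exact: continuous_measurable_fun.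
have bphi' := continuous_supp_bounded ab cphi' sphi'.
have sU : supported (u \_ D) by move=> x Dx; rewrite patchE memNset.
have sV : supported (v \_ D) by move=> x Dx; rewrite patchE memNset.
have := wk _ tphi.
set G := (Gamma (1 - al))^-1.
have -> : \int[mu]_(x in D) (v x * phi x) =
    - e * \int[mu]_x (phi^`()%classic x * fconv 1 (v \_ D) x).
  rewrite (fconv_adjoint ltr01)// Rintegral_mkcond -RintegralZl//; last first.
    exact: integrable_fconv_adjoint.
  apply: eq_Rintegral => x _; rewrite !patchE; case: ifPn => [/set_mem Dx|_]; last first.
    by rewrite mul0r mulr0.
  by rewrite {1}(test_function_repr tphi Dx) mulrCA.
have -> : \int[mu]_(x in D) (u x * fracD (opp_side s) a b al phi x) =
    - e * \int[mu]_x (phi^`()%classic x * (G * fconv (1 - al) (u \_ D) x)).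
  have -> : \int[mu]_x (phi^`()%classic x * (G * fconv (1 - al) (u \_ D) x)) =
      \int[mu]_x (G * (phi^`()%classic x * fconv (1 - al) (u \_ D) x)).
    by apply: eq_Rintegral => x _; rewrite mulrCA.
  rewrite RintegralZl//; last exact: integrable_fconv_bounded.
  rewrite (fconv_adjoint al1)// Rintegral_mkcond mulrA -RintegralZl//; last first.
    exact: integrable_fconv_adjoint.
  apply: eq_Rintegral => x _; rewrite !patchE; case: ifPn => [/set_mem Dx|_]; last first.
    by rewrite mul0r mulr0.
  have xab : a < x < b by move: Dx; rewrite /D/= in_itv/=.
  rewrite (fracD_test s ab al01 tphi xab).
  by rewrite -/e -/G; ring.
move=> /(congr1 (fun x => - e * x)); rewrite !mulrA mulrNN sgn_sideK !mul1r.
exact/esym.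
Qed.

Lemma integrable_pker1M (V : R -> R) (z : R) : mu.-integrable setT (EFin \o V) ->
  mu.-integrable setT (EFin \o (fun t => pker 1 (e * (z - t)) * V t)).
Proof.
move=> iV.
have := @integrableMr _ _ _ mu setT measurableT (fun t => pker 1 (e * (z - t))) (EFin \o V).
apply => //; first exact: mpkery.
exists 1; split; first exact: num_real.
move=> N N1 t _ /=; rewrite ger0_norm ?pker_ge0// (le_trans _ (ltW N1))//.
by rewrite pker1 lern1 leq_b1.
Qed.

(** The difference of two Heaviside kernels is, up to sign, the indicator of an interval between x
    and y, so the increment is at most the integral of |V| there. *)
Lemma fconv1_abs_continuous (V : R -> R) (c0 : R) : mu.-integrable setT (EFin \o V) ->
  abs_continuous a b (fun x => c0 + fconv 1 V x).
Proof.
move=> iV; apply: (abs_continuous_integral iV) => x y ax xy yb.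
have mV : measurable_fun setT V by case/integrableP : iV => /measurable_EFinP.
have i1 z := integrable_pker1M z iV.
have -> : c0 + fconv 1 V y - (c0 + fconv 1 V x) =
    \int[mu]_t ((pker 1 (e * (y - t)) - pker 1 (e * (x - t))) * V t).
  rewrite opprD addrACA subrr add0r -RintegralB//; try exact: i1.
  by apply: eq_Rintegral => t _; rewrite mulrBl.
have iB : mu.-integrable setT
    (EFin \o (fun t => (pker 1 (e * (y - t)) - pker 1 (e * (x - t))) * V t)).
  have := integrableB measurableT (i1 y) (i1 x).
  by apply: eq_integrable => // t _ /=; rewrite -EFinB mulrBl.
rewrite EFin_normr_Rintegral//; apply: le_trans (le_abse_integral _ _ _) _ => //.
  exact: (measurable_int _ iB).
rewrite -(@integral_itv_bndoo _ _ _ _ true false); last first.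
  by apply/measurable_EFinP; apply: measurable_funTS; exact: measurableT_comp.
rewrite [leRHS]integral_mkcond; apply: ge0_le_integral => //.
- by apply: measurableT_comp => //; exact: (measurable_int _ iB).
- apply/(measurable_restrictT _ _).1 => //.
  by apply/measurable_EFinP; apply: measurable_funTS; exact: measurableT_comp.
move=> t _; rewrite patchE mem_setE in_itv/= !pker1.
set B := (X in (_ <= X)%E).
have B0 : (0 <= B)%E by rewrite /B; case: ifP.
have [[-> _]|[-> _]] := ecase; rewrite ?mul1r ?mulN1r ?opprB !subr_gt0 /=.
- have [ty|ty] := ltP t y; have [tx|tx] := ltP t x; rewrite ?subrr ?mul0r ?normr0//.
    by rewrite /B tx (ltW ty)/= subr0 mul1r.
  by have := lt_le_trans tx (le_trans xy ty); rewrite ltxx.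
- have [ty|ty] := ltP y t; have [tx|tx] := ltP x t; rewrite ?subrr ?mul0r ?normr0//.
    by have := lt_le_trans ty (le_trans tx xy); rewrite ltxx.
  by rewrite /B ty (ltW tx)/= sub0r mulN1r normrN.
Qed.

Lemma fconv1_endpoint (V : R -> R) : supported V -> fconv 1 V x0 = 0.
Proof.
move=> sV; rewrite /fconv (_ : (fun y => _) = cst 0) ?Rintegral_cst ?mul0r//.
apply/funext => y; have [Dy|/sV ->] := pselect (D y); last by rewrite mulr0.
move: Dy; rewrite /D/= in_itv/= => /andP[ay yb]; rewrite pker1.
have [[-> ->]|[-> ->]] := ecase; rewrite ?mul1r ?mulN1r ?opprB subr_gt0 ltNge ltW// mul0r//.
Qed.

(** The reflection x -> z + y - x exchanges the two kernels. *)
Lemma fconv_swap (sigma tau y z : R) :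
  \int[mu]_x (pker sigma (e * (z - x)) * pker tau (e * (x - y))) =
  \int[mu]_x (pker tau (e * (z - x)) * pker sigma (e * (x - y))).
Proof.
pose h x := (pker sigma (e * (z - x)) * pker tau (e * (x - y)))%:E.
have mh : measurable_fun setT h.
  by apply/measurable_EFinP; apply: measurable_funM; [exact: mpkery|exact: mpkerx].
have N1 : `|-1| = 1 :> R by rewrite normrN normr1.
congr fine; transitivity (\int[mu]_t h (-1 * t + (z + y))%R)%E.
  exact: (integral_affine1 (z + y) N1 mh).
apply: eq_integral => t _; rewrite /h mulrC.
have -> : z - (-1 * t + (z + y)) = t - y by ring.
by have -> : -1 * t + (z + y) - y = z - t by ring.
Qed.

(* The two factors are both nonzero only for x strictly between y and z. *)
Lemma pker_between (sigma tau y z x : R) : a <= y <= b -> a <= z <= b ->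
  pker sigma (e * (z - x)) * pker tau (e * (x - y)) * \1_D x =
  pker sigma (e * (z - x)) * pker tau (e * (x - y)).
Proof.
move=> /andP[ay yb] /andP[az zb]; rewrite indicE.
have [|nD] := boolP (x \in D); first by rewrite mulr1.
rewrite mulr0 /pker; case: ifPn => zx; last by rewrite mul0r.
case: ifPn => xy; last by rewrite mulr0.
move/negP: nD; case; rewrite inE /D/= in_itv/=.
move: zx xy; have [[-> _]|[-> _]] := ecase; rewrite ?mul1r ?mulN1r ?opprB !subr_gt0.
- by move=> xz yx; rewrite (le_lt_trans ay yx) (lt_le_trans xz zb).
- by move=> zx xy; rewrite (le_lt_trans az zx) (lt_le_trans xy yb).
Qed.

Lemma x0_in : a <= x0 <= b.
Proof. by have [[_ ->]|[_ ->]] := ecase; rewrite lexx ltW. Qed.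

Lemma pker1_endpoint (x : R) : D x -> pker 1 (e * (x - x0)) = 1.
Proof.
rewrite /D/= in_itv/= => /andP[ax xb]; rewrite pker1.
by have [[-> ->]|[-> ->]] := ecase; rewrite ?mul1r ?mulN1r ?opprB subr_gt0 ?ax ?xb.
Qed.

Lemma kappaE (al x : R) : D x -> kappa s a b al x = pker al (e * (x - x0)).
Proof.
rewrite /D/= in_itv/= => /andP[ax xb]; rewrite /kappa /pker /e /x0.
by case: s; rewrite /= ?mul1r ?mulN1r ?opprB subr_gt0 ?ax ?xb.
Qed.

Lemma integrable_pkerD (sigma c y : R) : 0 < sigma -> `|c| = 1 -> a <= y <= b ->
  mu.-integrable setT (EFin \o (fun x => pker sigma (c * (x - y)) * \1_D x)).
Proof.
move=> s0 c1 yab; apply/integrableP; split.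
  by apply/measurable_EFinP; exact: mpkerxD.
under eq_integral do rewrite /= ger0_norm ?mulr_ge0 ?pker_ge0//.
exact: le_lt_trans (integral_pker_le _ c1 yab) (integral_pker_lty _ s0).
Qed.

Let galE (al z : R) : (fun x => pker al (e * (z - x)) * \1_D x) =
  (fun x => pker al (- e * (x - z)) * \1_D x).
Proof. by apply/funext => x; rewrite mulNr -mulrN opprB. Qed.

Let Dab z : D z -> a <= z <= b.
Proof. by rewrite /D/= in_itv/= => /andP[/ltW -> /ltW ->]. Qed.

Lemma integrable_pkerDr (al z : R) : 0 < al -> D z ->
  mu.-integrable setT (EFin \o (fun x => pker al (e * (z - x)) * \1_D x)).
Proof. by move=> al0 Dz; rewrite galE; apply: integrable_pkerD => //; exact: Dab. Qed.

(** Fubini with the unbounded weight of order al. For each y the product of the kernels integrates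
    to at most Gamma(al) Gamma(1 - al), so the identity holds at every z although the inner
    convolution converges only a.e. *)
Lemma fconv_semigroup (al : R) (U : R -> R) (z : R) : 0 < al < 1 -> D z ->
  mu.-integrable setT (EFin \o U) -> supported U ->
  \int[mu]_x (pker al (e * (z - x)) * \1_D x * fconv (1 - al) U x) =
  Gamma al * Gamma (1 - al) * fconv 1 U z /\
  mu.-integrable setT (fun x => (pker al (e * (z - x)) * \1_D x * fconv (1 - al) U x)%:E).
Proof.
move=> al01 Dz iU sU.
have KM y : U y != 0 -> (\int[mu]_x (`|pker (1 - al) (e * (x - y))| *
    `|(pker al (e * (z - x)) * \1_D x)|)%:E <= (Gamma al * Gamma (1 - al))%:E)%E.
  move=> /(supp_in sU) Dy.
  under eq_integral => x _.
    rewrite !ger0_norm ?mulr_ge0 ?pker_ge0// mulrC mulrAC pker_between; try exact: Dab.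
    over.
  rewrite (integral_pker_conv _ _ al01 e1) lee_fin pker1 ler_piMr ?lern1 ?leq_b1//.
  by rewrite mulr_ge0// ltW// gamma_gt0//; lra.
split; last first.
  exact: (integrable_kernel_l (mpkerxy (1 - al)) (mpkeryD al e z) iU KM).
rewrite (kernel_fubini (mpkerxy (1 - al)) (mpkeryD al e z) iU KM).
rewrite /fconv -RintegralZl//; last exact: integrable_pker1M.
apply: eq_Rintegral => y _; have [->|/(supp_in sU) Dy] := eqVneq (U y) 0.
  by rewrite mul0r !mulr0.
rewrite mulrA mulrC; congr (_ * _).
rewrite -[RHS]/(fine (Gamma al * Gamma (1 - al) * pker 1 (e * (z - y)))%:E).
rewrite -(integral_pker_conv _ _ al01 e1) /Rintegral; congr fine.
by apply: eq_integral => x _; rewrite /= mulrC mulrAC pker_between//; exact: Dab.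
Qed.

(** I^al and I^1 commute: Fubini on each side reduces the claim to commutativity of the convolution
    of the kernels. The bound required on the left comes from [pker 1] being at most 1. *)
Lemma fconv_comm (al : R) (V : R -> R) (z : R) : 0 < al -> D z ->
  mu.-integrable setT (EFin \o V) -> supported V ->
  \int[mu]_x (pker al (e * (z - x)) * \1_D x * fconv 1 V x) =
  \int[mu]_x (pker 1 (e * (z - x)) * \1_D x * fconv al V x) /\
  mu.-integrable setT (fun x => (pker al (e * (z - x)) * \1_D x * fconv 1 V x)%:E).
Proof.
move=> al0 Dz iV sV.
pose M := \int[mu]_x (pker al (e * (z - x)) * \1_D x).
have ig := integrable_pkerDr al0 Dz.
have KM y : V y != 0 -> (\int[mu]_x (`|pker 1 (e * (x - y))| *
    `|(pker al (e * (z - x)) * \1_D x)|)%:E <= M%:E)%E.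
  move=> /(supp_in sV) Dy.
  rewrite /M /Rintegral fineK; last exact: integrable_fin_num ig.
  apply: ge0_le_integral => //.
  - apply/measurable_EFinP; apply: measurable_funM; apply: measurableT_comp => //.
      exact: mpkerx.
    exact: mpkeryD.
  - by apply/measurable_EFinP; exact: mpkeryD.
  move=> x _; rewrite lee_fin !ger0_norm ?mulr_ge0 ?pker_ge0//.
  by rewrite ler_piMl ?mulr_ge0 ?pker_ge0// pker1 lern1 leq_b1.
split; last first.
  exact: (integrable_kernel_l (mpkerxy 1) (mpkeryD al e z) iV KM).
rewrite (kernel_fubini (mpkerxy 1) (mpkeryD al e z) iV KM).
rewrite (fconv_adjoint al0 iV sV (mpkeryD 1 e z)).
- apply: eq_Rintegral => y _; have [->|/(supp_in sV) Dy] := eqVneq (V y) 0.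
    exact: etrans (mul0r _) (esym (mul0r _)).
  apply: (congr1 (fun t => V y * t)).
  have E sigma tau : \int[mu]_x (pker tau (e * (x - y)) * (pker sigma (e * (z - x)) * \1_D x)) =
      \int[mu]_x (pker sigma (e * (z - x)) * pker tau (e * (x - y))).
    apply: eq_Rintegral => x _; rewrite /= mulrC mulrAC pker_between//; exact: Dab.
  by rewrite !E fconv_swap.
- by move=> x Dx; rewrite indicE memNset// mulr0.
- exists 1 => x; rewrite ger0_norm ?mulr_ge0 ?pker_ge0//.
  by apply: mulr_ile1; rewrite ?pker_ge0// ?pker1 ?indicE lern1 leq_b1.
Qed.

(** Up to Gamma factors, I^al of the constant 1 is I^1 of kappa: on D the constant 1 is the
    order-one kernel based at the endpoint [x0], and the two kernels commute. *)
Lemma integral_pker_kappa (al z : R) : D z ->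
  \int[mu]_x (pker al (e * (z - x)) * \1_D x) =
  \int[mu]_x (pker 1 (e * (z - x)) * (pker al (e * (x - x0)) * \1_D x)).
Proof.
move=> Dz; transitivity (\int[mu]_x (pker al (e * (z - x)) * pker 1 (e * (x - x0)))).
  apply: eq_Rintegral => x _; rewrite -(pker_between _ _ _ x0_in (Dab Dz)).
  have [Dx|Dx] := pselect (D x); first by rewrite pker1_endpoint// mulr1.
  by rewrite indicE memNset// !mulr0.
rewrite fconv_swap; apply: eq_Rintegral => x _.
by rewrite mulrA (pker_between _ _ _ x0_in (Dab Dz)).
Qed.

(** The primitive from -oo is constant on ]a, b[: equal to 0 for the left side, and to the whole
    integral of F for the right side. *)
Lemma ae_eq0_fconv1 (F : R -> R) : mu.-integrable setT (EFin \o F) ->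
  (forall z, D z -> fconv 1 F z = 0) -> {ae mu, forall x, D x -> F x = 0}.
Proof.
move=> iF F0; have [[eE _]|[eE _]] := ecase.
- apply: (@ae_eq0_Rintegral _ F a b 0) => // z zab.
  rewrite -Rintegral_itv_bndo_bndc; last exact: integrableS iF.
  rewrite -(F0 z) /D/= ?in_itv//= Rintegral_mkcond; apply: eq_Rintegral => x _.
  rewrite patchE mem_setE in_itv/= eE mul1r pker1 subr_gt0.
  by case: ifP; rewrite ?mul1r ?mul0r.
- apply: (@ae_eq0_Rintegral _ F a b (\int[mu]_(x in `]-oo, +oo[) F x)) => // z zab.
  apply/eqP; rewrite eq_sym -subr_eq0 Rintegral_itvB//; last exact: integrableS iF.
  rewrite -(F0 z) /D/= ?in_itv//= Rintegral_mkcond; apply/eqP/eq_Rintegral => x _.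
  rewrite patchE mem_setE in_itv/= andbT eE mulN1r opprB pker1 subr_gt0.
  by case: ifP; rewrite ?mul1r ?mul0r.
Qed.

Lemma mul_indic_out (r x : R) : ~ D x -> r * \1_D x = 0.
Proof. by move=> Dx; rewrite indicE memNset// mulr0. Qed.

Lemma fconvZ (c z : R) (f : R -> R) : mu.-integrable setT (EFin \o f) ->
  fconv 1 (fun x => c * f x) z = c * fconv 1 f z.
Proof.
move=> iF; rewrite /fconv -RintegralZl//; last exact: integrable_pker1M.
by apply: eq_Rintegral => x _; rewrite mulrCA.
Qed.

Lemma fconvB (z : R) (f1 f2 : R -> R) : mu.-integrable setT (EFin \o f1) ->
  mu.-integrable setT (EFin \o f2) ->
  fconv 1 (fun x => f1 x - f2 x) z = fconv 1 f1 z - fconv 1 f2 z.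
Proof.
move=> i1 i2; rewrite /fconv -RintegralB//; try exact: integrable_pker1M.
by apply: eq_Rintegral => x _; rewrite mulrBr.
Qed.

Lemma Rintegral_ae_eq (g w1 w2 : R -> R) : measurable_fun setT g -> supported g ->
  measurable_fun setT w1 -> measurable_fun setT w2 ->
  {ae mu, forall x, D x -> w1 x = w2 x} ->
  \int[mu]_x (g x * w1 x) = \int[mu]_x (g x * w2 x).
Proof.
move=> mg sg m1 m2 w12.
have mgw (w : R -> R) : measurable_fun setT w -> measurable_fun setT (fun x => (g x * w x)%:E).
  by move=> mw; apply/measurable_EFinP; exact: measurable_funM.
apply: (congr1 fine).
apply: (@ae_eq_integral _ _ R mu setT _ _ measurableT (mgw _ m1) (mgw _ m2)).
move: w12; apply: filterS; first exact: (ae_filter_ringOfSetsType mu).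
move=> x wx _; have [Dx|/sg ->] := pselect (D x); last by rewrite !mul0r.
by rewrite wx.
Qed.

Lemma fractional_representation (al : R) (u v : R -> R) : 0 < al < 1 ->
  mu.-integrable setT (EFin \o (u \_ D)) -> mu.-integrable setT (EFin \o (v \_ D)) ->
  is_weak_fracD s a b al u v ->
  {ae mu, forall x, D x -> u x - cst_c s a b al u * kappa s a b al x =
    (Gamma al)^-1 * fconv al (v \_ D) x}.
Proof.
move=> al01 iU iV wk.
have al0 : 0 < al by lra.
have al1 : 0 < 1 - al by lra.
have al101 : 0 < 1 - al < 1 by lra.
have G0 := gamma_gt0 al01; have G1 := gamma_gt0 al101.
have sU : supported (u \_ D) by move=> x Dx; rewrite patchE memNset.
have sV : supported (v \_ D) by move=> x Dx; rewrite patchE memNset.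
set U := u \_ D in iU sU *; set V := v \_ D in iV sV *.
pose w x := (Gamma (1 - al))^-1 * fconv (1 - al) U x.
have b1 : exists M : R, forall x, `|\1_D x| <= M :> R.
  by exists 1 => x; rewrite ger0_norm// indicE lern1 leq_b1.
have s1 : supported (\1_D : R -> R) by move=> x Dx; rewrite indicE memNset.
have mw : measurable_fun setT w.
  by apply: measurable_funM => //; exact: measurable_fconv.
have mV1 : measurable_fun setT (fconv 1 V) by exact: measurable_fconv.
have iw : mu.-integrable setT (fun x => (\1_D x * w x)%:E).
  have := integrableZl measurableT (Gamma (1 - al))^-1
    (integrable_fconv_bounded al1 iU sU mD s1 b1).
  apply: eq_integrable => // x _; rewrite -EFinM; congr (_%:E); rewrite /w; ring.
have iV1 := integrable_fconv_bounded ltr01 iV sV mD s1 b1.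
(* The difference I^(1-al) u - I^1 v is cut off to ]a, b[, since du Bois-Reymond takes a function
   integrable on the whole line. *)
pose H x := \1_D x * w x - \1_D x * fconv 1 V x.
have iH : mu.-integrable setT (EFin \o H) by exact: (integrableB measurableT iw iV1).
have [c0 Hc0] : exists c0, {ae mu, forall x, D x -> H x = c0}.
  apply: du_bois_reymond => // phi tphi.
  have [dphi cphi cphi'] := test_function_derivable tphi.
  have out := test_function_out tphi.
  have sphi' : supported (phi^`()%classic) by move=> y /out[].
  have mphi' : measurable_fun setT (phi^`()%classic : R -> R) by exact: continuous_measurable_fun.
  have bphi' := continuous_supp_bounded ab cphi' sphi'.
  have i1 : mu.-integrable setT (fun x => (phi^`()%classic x * w x)%:E).
    have := integrableZl measurableT (Gamma (1 - al))^-1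
      (integrable_fconv_bounded al1 iU sU mphi' sphi' bphi').
    apply: eq_integrable => // x _; rewrite -EFinM; congr (_%:E); rewrite /w; ring.
  have i2 := integrable_fconv_bounded ltr01 iV sV mphi' sphi' bphi'.
  transitivity (\int[mu]_x (phi^`()%classic x * w x - phi^`()%classic x * fconv 1 V x)).
    apply: eq_Rintegral => x _; rewrite /H indicE.
    have [Dx|/sphi' ->] := pselect (D x); first by rewrite mem_set// !mul1r mulrC mulrBr.
    by rewrite mulr0 !mul0r subr0.
  by rewrite RintegralB// (weak_fconv al01 iU iV wk tphi) subrr.
have Dw : {ae mu, forall x, D x -> w x = c0 + fconv 1 V x}.
  move: Hc0; apply: filterS; first exact: (ae_filter_ringOfSetsType mu).
  move=> x Hx Dx; have := Hx Dx; rewrite /H indicE mem_set// !mul1r => <-; ring.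
have cE : cst_c s a b al u = c0 / Gamma al.
  rewrite /cst_c -/x0; congr (_ / _).
  (* The explicit representative c0 + I^1 v takes the value c0 at [x0], where I^1 v vanishes. *)
  rewrite (@ac_value_eq _ a b x0 _ (fun x => c0 + fconv 1 V x))//.
  - by rewrite fconv1_endpoint ?addr0.
  - by have [[_ ->]|[_ ->]] := ecase; [left|right].
  - exact: fconv1_abs_continuous.
  move: Dw; apply: filterS; first exact: (ae_filter_ringOfSetsType mu).
  by move=> x wx Dx; rewrite -wx// fracIE.
pose kap x := pker al (e * (x - x0)) * \1_D x.
(* On ]a, b[ this is Gamma(al) (u - c kappa - I^al v), with the denominators cleared. *)
pose F x := Gamma al * U x - c0 * kap x - \1_D x * fconv al V x.
have ik : mu.-integrable setT (EFin \o kap) by exact: integrable_pkerD x0_in.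
have iGU : mu.-integrable setT (fun x => (Gamma al * U x)%:E).
  exact: (integrableZl measurableT _ iU).
have ick : mu.-integrable setT (fun x => (c0 * kap x)%:E).
  exact: (integrableZl measurableT _ ik).
have iVa := integrable_fconv_bounded al0 iV sV mD s1 b1.
have iF : mu.-integrable setT (EFin \o F).
  exact: (integrableB measurableT (integrableB measurableT iGU ick) iVa).
have F0 z : D z -> fconv 1 F z = 0.
  move=> Dz; have [T1 iT1] := fconv_semigroup al01 Dz iU sU.
  have [T3 iT3] := fconv_comm al0 Dz iV sV.
  pose g x := pker al (e * (z - x)) * \1_D x.
  have ig : mu.-integrable setT (EFin \o g).
    exact: integrable_pkerDr.
  have mg : measurable_fun setT g by exact: mpkeryD.
  (* Integrating the a.e. equation w = c0 + I^1 v against the kernel of order al, which amounts to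
     applying Gamma(al) I^al at the point z. *)
  have Tae : \int[mu]_x (g x * w x) = \int[mu]_x (g x * (c0 + fconv 1 V x)).
    have sg : supported g := fun x => @mul_indic_out _ x.
    have m2 : measurable_fun setT (fun x => c0 + fconv 1 V x) by exact: measurable_funD.
    exact: Rintegral_ae_eq mg sg mw m2 Dw.
  have L : \int[mu]_x (g x * w x) = Gamma al * fconv 1 U z.
    transitivity (\int[mu]_x ((Gamma (1 - al))^-1 * (g x * fconv (1 - al) U x))).
      by apply: eq_Rintegral => x _; rewrite /w mulrCA.
    rewrite (RintegralZl _ measurableT iT1) T1 mulrA mulrCA.
    by rewrite (mulVf (lt0r_neq0 G1)) mulr1.
  have RR : \int[mu]_x (g x * (c0 + fconv 1 V x)) =
      c0 * fconv 1 kap z + fconv 1 (fun x => \1_D x * fconv al V x) z.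
    transitivity (\int[mu]_x (c0 * g x + g x * fconv 1 V x)).
      by apply: eq_Rintegral => x _; rewrite mulrDr (mulrC c0).
    have icg : mu.-integrable setT (EFin \o (fun x => c0 * g x)).
      exact: (integrableZl measurableT _ ig).
    rewrite (RintegralD measurableT icg iT3) (RintegralZl _ measurableT ig) T3.
    rewrite /g (integral_pker_kappa _ Dz); apply: (congr1 (fun t => _ + t)).
    by apply: eq_Rintegral => x _; rewrite mulrA.
  rewrite /F (fconvB _ (integrableB measurableT iGU ick) iVa) (fconvB _ iGU ick).
  rewrite (fconvZ _ _ iU) (fconvZ _ _ ik).
  by rewrite -L Tae RR addrAC addrK subrr.
have : {ae mu, forall x, D x -> F x = 0} by exact: ae_eq0_fconv1.
apply: filterS; first exact: (ae_filter_ringOfSetsType mu).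
move=> x Fx Dx; have := Fx Dx; rewrite /F /U patchE indicE (mem_set Dx) mul1r.
move=> /eqP; rewrite subr_eq0 => /eqP <-; rewrite cE (kappaE _ Dx) /kap indicE (mem_set Dx) mulr1.
have := lt0r_neq0 G0; move: (Gamma al) => g g0.
by field.
Qed.

End fractional_representation.

(** * Integrability from the L^p norm and pointwise domination of I^al v *)

Section Lp_estimates.
Context {R : realType}.
Local Notation mu := (@lebesgue_measure R).

(** On an interval of finite length |v| <= 1 + |v|^p, as p >= 1. *)
Lemma integrable_normLp (p a b : R) (v : R -> R) : 1 <= p ->
  measurable_fun `]a, b[ v -> (normLp p `]a, b[ v < +oo)%E ->
  mu.-integrable setT (EFin \o (v \_ `]a, b[)).
Proof.
move=> p1 mv vfin.
have p0 : 0 < p by apply: lt_le_trans p1.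
have mV : measurable_fun setT (v \_ `]a, b[) by apply/(measurable_restrictT _ _).1.
have : v \_ `]a, b[ \in Lfun mu p%:E by rewrite inE/=; apply/andP; split; rewrite inE.
move=> /(Lfun_integrable p1) ivp.
have i1 : mu.-integrable setT (EFin \o \1_(`]a, b[)) by exact: integrable_indic_itv.
apply: (le_integrable _ _ _ (integrableD _ i1 ivp)) => //; first exact/measurable_EFinP.
move=> x _; rewrite /= lee_fin.
rewrite [leRHS]ger0_norm; last by rewrite addr_ge0 ?powR_ge0// indicE.
rewrite patchE indicE; case: ifPn => _; last by rewrite normr0 add0r powR_ge0.
have [v1|v1] := leP `|v x| 1; first by rewrite ler_wpDr ?powR_ge0.
by apply: ler_wpDl => //; rewrite le1r_powR// ltW.
Qed.

Lemma ae_eq_Lnorm (p : R) (f g : R -> R) : 0 < p -> measurable_fun setT f ->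
  measurable_fun setT g -> {ae mu, forall x, f x = g x} ->
  ('N[mu]_p%:E[EFin \o f] = 'N[mu]_p%:E[EFin \o g])%E.
Proof.
move=> p0 mf mg fg; rewrite unlock; apply: (congr1 (fun X => X `^ p^-1)%E).
have mp (h : R -> R) : measurable_fun setT h -> measurable_fun setT (fun x => (`|h x| `^ p)%:E).
  move=> mh; apply/measurable_EFinP; apply: (measurableT_comp (measurable_powR _)).
  exact: measurableT_comp.
apply: (@ae_eq_integral _ _ R mu setT _ _ measurableT (mp _ mf) (mp _ mg)).
move: fg; apply: filterS; first exact: (ae_filter_ringOfSetsType mu).
by move=> x -> _.
Qed.

Lemma fine_abs_le (X : \bar R) : (`|fine X|%:E <= `|X|)%E.
Proof. by case: X => [r| |] //=; rewrite normr0 leey. Qed.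

(** This holds at every x in ]a, b[, also where the convolution diverges: its real value is then 0.
    Young's inequality can therefore use it without exceptional points. *)
Lemma fconv_tker_le (s : side) (al a b x : R) (V : R -> R) :
  measurable_fun setT V -> (forall y, ~ `]a, b[%classic y -> V y = 0) ->
  `]a, b[%classic x ->
  (`|fconv s al V x|%:E <=
    \int[mu]_y (tker al (b - a) (sgn_side s * (x - y)) * `|V y|)%:E)%E.
Proof.
move=> mV sV; rewrite /= in_itv/= => /andP[ax xb].
have mk : measurable_fun setT (fun y : R => (pker al (sgn_side s * (x - y)) * V y)%:E).
  apply/measurable_EFinP; apply: measurable_funM => //.
  apply: measurableT_comp; first exact: measurable_pker.
  by apply: measurable_funM => //; exact: measurable_funB.
apply: le_trans (fine_abs_le (\int[mu]_y (pker al (sgn_side s * (x - y)) * V y)%:E)) _.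
apply: le_trans (le_abse_integral mu measurableT mk) _.
rewrite le_eqVlt; apply/orP; left; apply/eqP; apply: eq_integral => y _ /=; congr (_%:E).
rewrite normrM ger0_norm ?pker_ge0//.
have [yD|/sV ->] := pselect (`]a, b[%classic y); last by rewrite normr0 !mulr0.
congr (_ * _); rewrite /tker ifT//; move: yD; rewrite /= in_itv/= => /andP[ay yb].
by case: (s); rewrite /= ?mul1r ?mulN1r; lra.
Qed.

End Lp_estimates.

Theorem theorem5p11 (R : realType) (a b alpha : R) (s : side) :
  a < b -> 0 < alpha < 1 ->
  exists2 C : R, 0 < C &
    forall p : R, 1 <= p ->
    forall u v : R -> R, fracW s a b alpha p u -> is_weak_fracD s a b alpha u v ->
      (normLp p `]a, b[ (fun x => u x - cst_c s a b alpha u * kappa s a b alpha x)%R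
        <= C%:E * normLp p `]a, b[ v)%E.
Proof.
move=> ab al01; have al0 : 0 < alpha by lra.
have G0 := gamma_gt0 al01.
have ik : (@lebesgue_measure R).-integrable setT (EFin \o tker alpha (b - a)).
  exact: integrable_tker.
pose k t := (Gamma alpha)^-1 * tker alpha (b - a) t.
have tk0 t : 0 <= tker alpha (b - a) t by rewrite /tker; case: ifP => // _; exact: pker_ge0.
have k0 t : 0 <= k t by rewrite mulr_ge0// invr_ge0 ltW.
have ikk : (@lebesgue_measure R).-integrable setT (EFin \o k).
  exact: (integrableZl measurableT _ ik).
have mk : measurable_fun setT k by case/integrableP : ikk => /measurable_EFinP.
(* The mass of the truncated kernel: 1/Gamma(alpha) times the integral of t^(alpha-1) over ]0, b -
   a[, fixed before p, u and v are introduced. *)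
pose K := fine (\int[lebesgue_measure]_t (k t)%:E)%E.
have kK : (\int[lebesgue_measure]_t (k t)%:E = K%:E)%E.
  by rewrite /K fineK//; exact: (integrable_fin_num _ ikk).
have K0 : 0 <= K by rewrite /K fine_ge0//; apply: integral_ge0 => t _; rewrite lee_fin.
(* Only K >= 0 has been recorded; adding 1 makes the constant positive. *)
exists (K + 1); first by rewrite ltr_wpDl.
move=> p p1 u v _ wk; have p0 : 0 < p by apply: lt_le_trans p1.
(* If the norm of v is infinite, the right side is +oo because K + 1 > 0. *)
have [vfin|] := ltP (normLp p `]a, b[ v) +oo%E; last first.
  rewrite leye_eq => /eqP ->; rewrite gt0_muley ?leey// lte_fin.
  by rewrite ltr_wpDl.
have [iu [mv _ _] _] := wk.
have iU : lebesgue_measure.-integrable setT (EFin \o (u \_ `]a, b[)).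
  exact/Lfun1_integrable.
have iV := integrable_normLp p1 mv vfin.
have mU : measurable_fun setT (u \_ `]a, b[) by case/integrableP : iU => /measurable_EFinP.
have mV : measurable_fun setT (v \_ `]a, b[) by case/integrableP : iV => /measurable_EFinP.
have sV y : ~ `]a, b[%classic y -> (v \_ `]a, b[) y = 0 by move=> Dy; rewrite patchE memNset.
have repr := fractional_representation ab al01 iU iV wk.
(* I^al v cut off to ]a, b[: it agrees a.e. on the whole line with the extension by zero of u - c
   kappa, and there Young's inequality applies. *)
pose w x := (Gamma alpha)^-1 * (\1_(`]a, b[) x * fconv s alpha (v \_ `]a, b[) x).
have mw : measurable_fun setT w.
  apply: measurable_funM => //; apply: measurable_funM.
    by apply: measurable_indic; exact: measurable_itv.
  exact: measurable_fconv.
set c := cst_c s a b alpha u in repr *.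
set f := (fun x => u x - c * kappa s a b alpha x).
have mf : measurable_fun setT (f \_ `]a, b[).
  pose x0 := match s with Left => a | Right => b end.
  have -> : f \_ `]a, b[ = fun x => (u \_ `]a, b[) x -
      c * (pker alpha (sgn_side s * (x - x0)) * \1_(`]a, b[) x).
    apply/funext => x; rewrite !patchE indicE; case: ifPn => [/set_mem Dx|_].
      by rewrite /f kappaE// mulr1.
    by rewrite mulr0 mulr0 subr0.
  apply: measurable_funB => //; apply: measurable_funM => //; apply: measurable_funM.
    apply: measurableT_comp; first exact: measurable_pker.
    by apply: measurable_funM => //; exact: measurable_funB.
  by apply: measurable_indic; exact: measurable_itv.
have fw : {ae lebesgue_measure, forall x, (f \_ `]a, b[) x = w x}.
  move: repr; apply: filterS; first exact: (ae_filter_ringOfSetsType lebesgue_measure).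
  move=> x fx; rewrite patchE /w indicE; case: ifPn => [/set_mem Dx|_].
    by rewrite mul1r -fx.
  by rewrite mul0r mulr0.
rewrite /normLp (ae_eq_Lnorm p0 mf mw fw).
have wle x : (`|w x|%:E <=
    \int[lebesgue_measure]_y (k (sgn_side s * (x - y)) * `|(v \_ `]a, b[) y|)%:E)%E.
  rewrite /w indicE; have [Dx|Dx] := boolP (x \in `]a, b[%classic); last first.
    rewrite mul0r mulr0 normr0; apply: integral_ge0 => y _.
    by rewrite lee_fin mulr_ge0.
  rewrite mul1r normrM ger0_norm ?invr_ge0 ?(ltW G0)// EFinM.
  apply: le_trans (lee_wpmul2l _ (fconv_tker_le _ _ mV sV (set_mem Dx))) _.
    by rewrite lee_fin invr_ge0 ltW.
  rewrite -ge0_integralZl//.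
  - rewrite le_eqVlt; apply/orP; left; apply/eqP; apply: eq_integral => y _.
    by rewrite -EFinM mulrA.
  - apply/measurable_EFinP; apply: measurable_funM; last exact: measurableT_comp.
    apply: measurableT_comp; first by case/integrableP : ik => /measurable_EFinP.
    by apply: measurable_funM => //; exact: measurable_funB.
  - by move=> y _; rewrite lee_fin mulr_ge0.
  - by rewrite lee_fin invr_ge0 ltW.
apply: le_trans (Lnorm_young p1 (norm_sgn_side s) mk mV mw k0 kK wle) _.
apply: lee_wpmul2r; first exact: Lnorm_ge0.
by rewrite lee_fin lerDl.
Qed.
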